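(* For all $r,t>0$ the Yor integral $F_t(r)$ has the representation $$F_t(r)=\frac{2}{r\pi^2}\int_0^\infty e^{-\frac t2\tau^2}\,\tau\sinh(\pi\tau)\,K_{i\tau}(r)\,d\tau,$$ and reciprocally, for each $t>0$ and $\tau>0$, $$\int_0^\infty K_{i\tau}(r)F_t(r)\,dr=e^{-\frac t2\tau^2}.$$
   Context: The Yor integral is defined for $r,t>0$ by $$F_t(r)=\frac{e^{\pi^2/2t}}{\sqrt{2\pi^3t}}\int_0^\infty\exp\left(-\frac{y^2}{2t}\right)\exp(-r\cosh y)\,\sinh y\,\sin\left(\frac{\pi y}{t}\right)dy.$$ $K_\nu$ is the modified Bessel function (Macdonald function), $K_\nu(x)=\int_0^\infty e^{-x\cosh u}\cosh(\nu u)\,du$ for $x>0$; so $K_{i\tau}(x)=\int_0^\infty e^{-x\cosh u}\cos(\tau u)\,du$.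
   Formalization: Both printed constants are off by a factor 2 for the given F_t(r): the formal theorem has 1/(rπ²) in place of 2/(rπ²) in the representation of F_t(r), and e^{-tτ²/2}/2 in place of e^{-tτ²/2} in the reciprocal formula. *)

(* Defs.v *)
From HB Require Import structures.
From mathcomp Require Import all_boot all_order all_algebra.
From mathcomp Require Import all_classical all_reals all_analysis.

Set Implicit Arguments.
Unset Strict Implicit.
Unset Printing Implicit Defensive.

Import Order.TTheory GRing.Theory Num.Theory.
Import numFieldNormedType.Exports.

Local Open Scope classical_set_scope.
Local Open Scope ring_scope.

Definition cosh (R : realType) (x : R) : R := (expR x + expR (- x)) / 2.

Definition sinh (R : realType) (x : R) : R := (expR x - expR (- x)) / 2.

(* The Macdonald function K_{i tau}(x) of purely imaginary order, meaningful
   for 0 < x: the factor cosh (nu u) of the integral representation of K_nu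
   equals cos (tau u) at nu = i tau. *)
Definition macdonald_im (R : realType) (tau x : R) : R :=
  \int[@lebesgue_measure R]_(u in `]0, +oo[)
    (expR (- (x * cosh u)) * cos (tau * u)).

(* The Yor integral F_t(r), meaningful for 0 < r and 0 < t. In this
   normalisation r * F_t(r) is the Hartman-Watson function theta_r(t), i.e.
   the integral of exp (- nu^2 t / 2) * r * F_t(r) over t > 0 is I_nu(r). *)
Definition yor_integral (R : realType) (t r : R) : R :=
  expR (pi ^+ 2 / (2 * t)) / Num.sqrt (2 * pi ^+ 3 * t) *
  \int[@lebesgue_measure R]_(y in `]0, +oo[)
    (expR (- (y ^+ 2 / (2 * t))) * expR (- (r * cosh y)) * sinh y *
     sin (pi * y / t)).

(* Main.v *)
Require Import Defs.
From HB Require Import structures.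
From mathcomp Require Import all_boot all_order all_algebra.
From mathcomp Require Import all_classical all_reals all_analysis.
From mathcomp Require Import measurable_realfun.
From mathcomp Require Import ring lra.

Import Order.TTheory GRing.Theory Num.Theory.
Import numFieldNormedType.Exports.

Local Open Scope classical_set_scope.
Local Open Scope ring_scope.

(** Both formulas are Fubini interchanges followed by an explicit Fourier integral;
the integrands decay fast enough that all interchanges are absolutely convergent.

For the first formula, integration by parts ([macdonald_by_parts]) gives
tau * K_{i tau}(r) = int r sinh u exp (- r cosh u) sin (tau u) du, which trades
the factor tau for a sine.  After interchanging the integrals over tau and u,
the integral over tau is that of a Gaussian times sinh (pi tau) sin (tau u)
([integral_gauss_sinh_sin]): completing the square turns sinh (pi tau) into two
translations by pi / t, which produce sin (pi u / t) and the constant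
exp (pi ^ 2 / (2 t)) of the Yor integral.

For the second formula, the integral over r of K_{i tau}(r) exp (- r cosh y) is
the integral over u of cos (tau u) / (cosh u + cosh y) ([laplace_macdonald]),
whose value is pi sin (tau y) / (sinh y sinh (pi tau)) ([cos_over_cosh_sum]).
The factor sinh y of the Yor integral cancels, and what remains is a Gaussian
times sin (pi y / t) sin (tau y) ([integral_gauss_sin_sin]), which produces the
sinh (pi tau) that cancels the denominator.

The value of the transform of 1 / (cosh u + cosh y) is usually found by
residues.  Here, sinh y / (cosh u + cosh y) is half the difference of two translates
of tanh (u / 2), so that its transform follows, by differentiation in y, from the
one of sech (s / 2) ^ 2 ([sech2_transform]).  The latter is computed with real
integrals only.  The integrals of cos (tau s) sech (s / 2) ^ (2 n) over the line
and of cosh (2 tau x) cos x ^ (2 n) over [0, pi / 2] satisfy first-order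
recurrences in n whose tau-dependent factors n ^ 2 + tau ^ 2 are inverse to each
other.  The product of the two integrals, divided by its value at tau = 0, is
therefore independent of n.  It tends to 1 because both weights concentrate at
0, so it equals 1 for the smallest n, where the second integral is the
elementary sinh (pi tau) / (2 tau). *)

(** * Differentiation, continuity and measurability rules *)

Section pointwise_rules.
Context {R : realType}.
Implicit Types (f g : R -> R) (x a b c : R).

Lemma derive_cst c x : is_derive x 1 (fun=> c) (0 : R).
Proof. exact: is_derive_cst. Qed.

Lemma derive_id x : is_derive x 1 (fun y : R => y) (1 : R).
Proof. exact: is_derive_id. Qed.

Lemma derive_add f g x a b : is_derive x 1 f a -> is_derive x 1 g b ->
  is_derive x 1 (fun y => f y + g y) (a + b).
Proof. by move=> fa gb; exact: is_deriveD. Qed.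

Lemma derive_opp f x a : is_derive x 1 f a ->
  is_derive x 1 (fun y => - f y) (- a).
Proof. by move=> fa; exact: is_deriveN. Qed.

Lemma derive_mul f g x a b : is_derive x 1 f a -> is_derive x 1 g b ->
  is_derive x 1 (fun y => f y * g y) (f x * b + g x * a).
Proof. by move=> fa gb; exact: is_deriveM. Qed.

Lemma derive_pow f x a n : is_derive x 1 f a ->
  is_derive x 1 (fun y => f y ^+ n) (n%:R * f x ^+ n.-1 * a).
Proof.
move=> fa; have -> : (fun y => f y ^+ n) = f ^+ n.
  by apply/funext => y; rewrite exprfctE.
exact: is_deriveX.
Qed.

Lemma derive_inv f x a : f x != 0 -> is_derive x 1 f a ->
  is_derive x 1 (fun y => (f y)^-1) (- (a / f x ^+ 2)).
Proof.
move=> f0 fa; apply: (is_derive_eq (is_deriveV f0 fa)).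
by rewrite scaleNr [_ *: _]mulrC.
Qed.

Lemma derive_comp g f x a b : is_derive (f x) 1 g b -> is_derive x 1 f a ->
  is_derive x 1 (fun y => g (f y)) (b * a).
Proof. by move=> gb fa; exact: (@is_derive1_comp _ g f). Qed.

Lemma derive_exp f x a : is_derive x 1 f a ->
  is_derive x 1 (fun y => expR (f y)) (expR (f x) * a).
Proof. by move=> fa; exact: (@is_derive1_comp _ expR f). Qed.

Lemma derive_sin f x a : is_derive x 1 f a ->
  is_derive x 1 (fun y => sin (f y)) (cos (f x) * a).
Proof. by move=> fa; exact: (@is_derive1_comp _ sin f). Qed.

Lemma derive_cos f x a : is_derive x 1 f a ->
  is_derive x 1 (fun y => cos (f y)) (- sin (f x) * a).
Proof. by move=> fa; exact: (@is_derive1_comp _ cos f). Qed.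

Lemma derive_cosh f x a : is_derive x 1 f a ->
  is_derive x 1 (fun y => cosh (f y)) (sinh (f x) * a).
Proof.
move=> fa; have e1 := derive_exp f x a fa.
have e2 := derive_exp _ _ _ (derive_opp f x a fa).
apply: (is_derive_eq (derive_mul (fun y => expR (f y) + expR (- f y))
  (fun=> 2^-1) _ _ _ (derive_add _ _ _ _ _ e1 e2) (derive_cst _ _))).
by rewrite /sinh; field.
Qed.

Lemma derive_sinh f x a : is_derive x 1 f a ->
  is_derive x 1 (fun y => sinh (f y)) (cosh (f x) * a).
Proof.
move=> fa; have e1 := derive_exp f x a fa.
have e2 := derive_opp _ _ _ (derive_exp _ _ _ (derive_opp f x a fa)).
apply: (is_derive_eq (derive_mul (fun y => expR (f y) - expR (- f y))
  (fun=> 2^-1) _ _ _ (derive_add _ _ _ _ _ e1 e2) (derive_cst _ _))).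
by rewrite /cosh; field.
Qed.

Lemma is_derive_continuous f (df : R -> R) :
  (forall x, is_derive x 1 f (df x)) -> continuous f.
Proof.
move=> fdf x; apply/differentiable_continuous/derivable1_diffP.
by have [] := fdf x.
Qed.

Lemma continuous_cosh : continuous (@cosh R).
Proof.
apply: (@is_derive_continuous _ (fun x => sinh x * 1)) => x.
by apply: derive_cosh; exact: derive_id.
Qed.

Lemma continuous_sinh : continuous (@sinh R).
Proof.
apply: (@is_derive_continuous _ (fun x => cosh x * 1)) => x.
by apply: derive_sinh; exact: derive_id.
Qed.

Lemma cont_comp f g : continuous f -> continuous g ->
  continuous (fun x => f (g x)).
Proof. by move=> cf cg x; apply: continuous_comp; [exact: cg|exact: cf]. Qed.

Lemma cont_inv f : (forall x, f x != 0) -> continuous f ->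
  continuous (fun x => (f x)^-1).
Proof. by move=> f0 cf x; apply: cvgV => //; exact: cf. Qed.

Lemma cont_pow f n : continuous f -> continuous (fun x => f x ^+ n).
Proof. exact: (cont_comp (fun y => y ^+ n) f (@exprn_continuous _ n)). Qed.

End pointwise_rules.

Lemma meas_comp {d} {T : measurableType d} {R : realType} (f : R -> R)
    (g : T -> R) : continuous f -> measurable_fun setT g ->
  measurable_fun setT (fun x => f (g x)).
Proof. by move=> cf; apply: measurableT_comp; exact: continuous_measurable_fun. Qed.

(** The rules are applied with instance resolution switched off: the derivatives
found by instances are written with scalar multiplications, which [ring] and
[field] do not read as products. *)
Ltac der :=
  lazymatch goal with
  | |- is_derive _ _ (fun _ => ?c) _ => exact: derive_cst
  | |- is_derive _ _ (fun y => y) _ => exact: derive_id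
  | |- is_derive _ _ (fun y => @?f y + @?g y) _ =>
    notypeclasses refine (derive_add f g _ _ _ _ _); der
  | |- is_derive _ _ (fun y => - @?f y) _ =>
    notypeclasses refine (derive_opp f _ _ _); der
  | |- is_derive _ _ (fun y => @?f y * @?g y) _ =>
    notypeclasses refine (derive_mul f g _ _ _ _ _); der
  | |- is_derive _ _ (fun y => @?f y ^+ _) _ =>
    notypeclasses refine (derive_pow f _ _ _ _); der
  | |- is_derive _ _ (fun y => (@?f y)^-1) _ =>
    notypeclasses refine (derive_inv f _ _ _ _); [|der]
  | |- is_derive _ _ (fun y => expR (@?f y)) _ =>
    notypeclasses refine (derive_exp f _ _ _); der
  | |- is_derive _ _ (fun y => sin (@?f y)) _ =>
    notypeclasses refine (derive_sin f _ _ _); der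
  | |- is_derive _ _ (fun y => cos (@?f y)) _ =>
    notypeclasses refine (derive_cos f _ _ _); der
  | |- is_derive _ _ (fun y => cosh (@?f y)) _ =>
    notypeclasses refine (derive_cosh f _ _ _); der
  | |- is_derive _ _ (fun y => sinh (@?f y)) _ =>
    notypeclasses refine (derive_sinh f _ _ _); der
  | |- _ => idtac
  end.

Ltac cont :=
  lazymatch goal with
  | |- continuous (fun _ => ?c) => move=> ?; exact: cvg_cst
  | |- continuous (fun y => y) => move=> ?; exact: cvg_id
  | |- continuous (fun y => @?f y + @?g y) =>
    let x := fresh in move=> x; apply: (@cvgD _ _ _ _ _ f g); move: x;
    [change (continuous f)|change (continuous g)]; cont
  | |- continuous (fun y => - @?f y) =>
    let x := fresh in move=> x; apply: (@cvgN _ _ _ _ _ f); move: x;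
    change (continuous f); cont
  | |- continuous (fun y => @?f y * @?g y) =>
    let x := fresh in move=> x; apply: (@cvgM _ _ _ _ f g); move: x;
    [change (continuous f)|change (continuous g)]; cont
  | |- continuous (fun y => @?f y ^+ _) => apply: (cont_pow f); cont
  | |- continuous (fun y => (@?f y)^-1) => apply: (cont_inv f); [|cont]
  | |- continuous (fun y => expR (@?f y)) =>
    apply: (cont_comp expR f); [exact: continuous_expR|cont]
  | |- continuous (fun y => sin (@?f y)) =>
    apply: (cont_comp sin f); [exact: continuous_sin|cont]
  | |- continuous (fun y => cos (@?f y)) =>
    apply: (cont_comp cos f); [exact: continuous_cos|cont]
  | |- continuous (fun y => cosh (@?f y)) =>
    apply: (cont_comp (@cosh _) f); [exact: continuous_cosh|cont]
  | |- continuous (fun y => sinh (@?f y)) =>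
    apply: (cont_comp (@sinh _) f); [exact: continuous_sinh|cont]
  | |- continuous (fun y => `| @?f y |) =>
    apply: (cont_comp Num.norm f); [exact: norm_continuous|cont]
  | |- _ => idtac
  end.

Ltac meas :=
  lazymatch goal with
  | |- measurable_fun _ (fun _ => ?c) => exact: measurable_cst
  | |- measurable_fun _ (fun y => y) => exact: measurable_id
  | |- measurable_fun _ (fun y => y.1) => exact: measurable_fst
  | |- measurable_fun _ (fun y => y.2) => exact: measurable_snd
  | |- measurable_fun _ (fun y => @?f y + @?g y) =>
    apply: (@measurable_funD _ _ _ _ f g); meas
  | |- measurable_fun _ (fun y => - @?f y) =>
    apply: (@measurable_funN _ _ _ _ f); meas
  | |- measurable_fun _ (fun y => @?f y * @?g y) =>
    apply: (@measurable_funM _ _ _ _ f g); meas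
  | |- measurable_fun _ (fun y => @?f y ^+ ?n) =>
    apply: (@measurable_funX _ _ _ _ f n); meas
  | |- measurable_fun _ (fun y => expR (@?f y)) =>
    apply: (meas_comp expR f (@continuous_expR _)); meas
  | |- measurable_fun _ (fun y => sin (@?f y)) =>
    apply: (meas_comp sin f (@continuous_sin _)); meas
  | |- measurable_fun _ (fun y => cos (@?f y)) =>
    apply: (meas_comp cos f (@continuous_cos _)); meas
  | |- measurable_fun _ (fun y => cosh (@?f y)) =>
    apply: (meas_comp (@cosh _) f continuous_cosh); meas
  | |- measurable_fun _ (fun y => sinh (@?f y)) =>
    apply: (meas_comp (@sinh _) f continuous_sinh); meas
  | |- _ => idtac
  end.

Ltac isder := notypeclasses refine (is_derive_eq _ _); [der|].

(** * Integrals over the real line *)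

Section integration_tools.
Context {R : realType}.
Notation mu := (@lebesgue_measure R).
Implicit Types (f g F : R -> R) (D : set R).

Lemma measurable_integrable_le D f g : measurable D -> measurable_fun D f ->
  mu.-integrable D (EFin \o g) -> (forall x, D x -> `|f x| <= g x) ->
  mu.-integrable D (EFin \o f).
Proof.
move=> mD mf ig fg; apply: le_integrable ig => //; first exact/measurable_EFinP.
by move=> x Dx /=; rewrite lee_fin (le_trans (fg _ Dx))// ler_norm.
Qed.

Lemma continuous_integrable_le f g : continuous f ->
  mu.-integrable setT (EFin \o g) -> (forall x, `|f x| <= g x) ->
  mu.-integrable setT (EFin \o f).
Proof.
move=> cf ig fg; apply: measurable_integrable_le ig _ => //.
exact: continuous_measurable_fun.
Qed.

Lemma integrable_itv f : mu.-integrable setT (EFin \o f) ->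
  forall i : interval R, mu.-integrable [set` i] (EFin \o f).
Proof. by move=> + i; apply: integrableS. Qed.

Lemma Rintegral_EFin D f : measurable D -> mu.-integrable D (EFin \o f) ->
  (\int[mu]_(x in D) f x)%:E = (\int[mu]_(x in D) (f x)%:E)%E.
Proof. by move=> mD iF; rewrite fineK//; exact: integrable_fin_num. Qed.

Lemma ge0_integral_shift f c : continuous f -> (forall x, 0 <= f x) ->
  (\int[mu]_x (f (x + c))%:E = \int[mu]_x (f x)%:E)%E.
Proof.
move=> cf f0.
have dE : ((fun x : R => x + c)^`()%classic) = cst 1.
  apply/funext => x; rewrite derive1E.
  have H : is_derive x 1 (fun x => x + c) (1 + 0) by der.
  by rewrite (@derive_val _ _ _ _ _ _ _ H) addr0.
rewrite (@increasing_ge0_integration_by_substitutionT _ (fun x => x + c) f)//.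
- by apply: eq_integral => x _; rewrite dE /= fctE/= mulr1.
- by move=> x y xy; rewrite ltrD2r.
- by rewrite dE; move=> x; exact: cvg_cst.
- by rewrite dE; exact: is_cvg_cst.
- by rewrite dE; exact: is_cvg_cst.
- exact: cvg_addrr_Ny.
- exact: cvg_addrr.
Qed.

Lemma integrable_shift f c : continuous f -> mu.-integrable setT (EFin \o f) ->
  mu.-integrable setT (EFin \o (fun x => f (x + c))).
Proof.
move=> cf /integrableP[mf fi].
have cs : continuous (fun x => f (x + c)) by apply: (cont_comp f); cont.
apply/integrableP; split.
  by apply/measurable_EFinP; exact: continuous_measurable_fun.
move: fi; under eq_integral do rewrite /=.
under [in X in _ -> X]eq_integral do rewrite /=.
rewrite (@ge0_integral_shift (fun x => `|f x|))//.
by cont.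
Qed.

(** The substitution rule holds for continuous nonnegative integrands; both
f + |f| and |f| are of this kind, and f is their difference. *)
Lemma Rintegral_shift f c : continuous f -> mu.-integrable setT (EFin \o f) ->
  \int[mu]_x f (x + c) = \int[mu]_x f x.
Proof.
move=> cf fi.
have cs : continuous (fun x => f (x + c)) by apply: (cont_comp f); cont.
have fsi := integrable_shift f c cf fi.
have nfi := integrable_norm fi.
have nfsi := integrable_norm fsi.
have H1 : \int[mu]_x (f x + `|f x|) = \int[mu]_x (f (x + c) + `|f (x + c)|).
  rewrite /Rintegral (@ge0_integral_shift (fun x => f x + `|f x|))//; first by cont.
  by move=> x; rewrite -lerBlDl sub0r ler_normr lexx orbT.
have H2 : \int[mu]_x `|f x| = \int[mu]_x `|f (x + c)|.
  by rewrite /Rintegral (@ge0_integral_shift (fun x => `|f x|))//; cont.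
move: H1; rewrite !RintegralD// H2 => H1.
by apply: (addIr (\int[mu]_x `|f (x + c)|)); rewrite -H1.
Qed.

Lemma ge0_integral_even f : continuous f -> (forall x, 0 <= f x) ->
  (forall x, f (- x) = f x) ->
  (\int[mu]_x (f x)%:E = 2%:E * \int[mu]_(x in `]0%R, +oo[) (f x)%:E)%E.
Proof.
move=> cf f0 ef; have ef' : f =1 f \o -%R by move=> x /=; rewrite ef.
rewrite (ge0_symfun_integralT f0 cf ef'); congr (_ * _)%E.
rewrite -set_itvcy.
rewrite integral_itv_obnd_cbnd//.
by apply/measurable_EFinP/measurable_funTS; exact: continuous_measurable_fun.
Qed.

(** As for translations, f is a difference of the nonnegative functions f + |f|
and |f|, which are again even. *)
Lemma Rintegral_even f : continuous f -> mu.-integrable setT (EFin \o f) ->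
  (forall x, f (- x) = f x) ->
  \int[mu]_(x in `]0, +oo[) f x = (\int[mu]_x f x) / 2.
Proof.
move=> cf fi ef; have nfi := integrable_norm fi.
have ge0E (h : R -> R) : continuous h -> (forall x, 0 <= h x) ->
    (forall x, h (- x) = h x) -> mu.-integrable setT (EFin \o h) ->
    \int[mu]_x h x = 2 * \int[mu]_(x in `]0, +oo[) h x.
  move=> ch h0 eh hi; apply: EFin_inj; rewrite EFinM.
  have hip := integrable_itv _ hi `]0, +oo[.
  rewrite (Rintegral_EFin _ _ _ hi)// (Rintegral_EFin _ _ _ hip)//.
  exact: ge0_integral_even.
have H1 : \int[mu]_x (f x + `|f x|) =
    2 * \int[mu]_(x in `]0, +oo[) (f x + `|f x|).
  apply: ge0E; first by cont.
  - by move=> x; rewrite -lerBlDl sub0r ler_normr lexx orbT.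
  - by move=> x; rewrite !ef.
  - exact: (integrableD measurableT fi nfi).
have H2 : \int[mu]_x `|f x| = 2 * \int[mu]_(x in `]0, +oo[) `|f x|.
  apply: ge0E => //; first by cont.
  by move=> x; rewrite ef.
have := integrable_itv _ fi `]0, +oo[; have := integrable_itv _ nfi `]0, +oo[.
move=> fip nfip.
move: H1; rewrite !RintegralD// H2; lra.
Qed.

(** Dominated convergence, the truncations of f being bounded by |f|. *)
Lemma Rintegral_sym_cvg f : continuous f -> mu.-integrable setT (EFin \o f) ->
  \int[mu]_(x in `[(- n%:R)%R, n%:R]) f x @[n --> \oo] --> \int[mu]_x f x.
Proof.
move=> cf fi; apply: fine_cvg; rewrite Rintegral_EFin//.
have mf : measurable_fun setT f by exact: continuous_measurable_fun.
under eq_fun do rewrite integral_mkcond.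
apply: (@dominated_cvg _ _ _ mu setT measurableT _ _ (fun x => `|f x|%:E)).
- move=> n; apply/(measurable_restrictT _ _).1 => //.
  by apply: measurable_funTS; exact/measurable_EFinP.
- move=> x _; apply: cvg_near_cst.
  near=> n; rewrite /restrict mem_set//= in_itv/=; rewrite -ler_norml.
  by near: n; exact: nbhs_infty_ger.
- by [].
- exact: (integrable_norm fi).
- move=> n x _; rewrite /restrict; case: ifPn => _ //=.
  by rewrite normr0 lee_fin.
Unshelve. all: by end_near. Qed.

(** The decay hypotheses are a quantitative form of F --> L at +oo and F --> L'
at -oo that is easy to check on the integrands below. *)
Lemma Rintegral_derivative F f (L L' C : R) :
  (forall x : R, is_derive x 1 F (f x)) -> continuous f ->
  mu.-integrable setT (EFin \o f) ->
  (forall x, 0 <= x -> `|F x - L| * x ^+ 2 <= C) ->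
  (forall x, 0 <= x -> `|F (- x) - L'| * x ^+ 2 <= C) ->
  \int[mu]_x f x = L - L'.
Proof.
move=> dF cf fi FC FC'.
have cF := is_derive_continuous F f dF.
have ftc n : \int[mu]_(x in `[(- n.+1%:R)%R, n.+1%:R]) f x =
    F n.+1%:R - F (- n.+1%:R).
  rewrite /Rintegral (@continuous_FTC2 _ f F)//.
  - by rewrite -subr_gt0 opprK addr_gt0.
  - exact: continuous_subspaceT.
  - split.
    + by move=> x _; case: (dF x).
    + by apply: cvg_at_right_filter; exact: cF.
    + by apply: cvg_at_left_filter; exact: cF.
  - by move=> x _; rewrite derive1E; case: (dF x).
have := Rintegral_sym_cvg f cf fi; rewrite -(cvg_shiftS _).
under eq_fun do rewrite ftc.
move=> l1.
have decay (G : R -> R) (l : R) :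
    (forall x, 0 <= x -> `|G x - l| * x ^+ 2 <= C) ->
    G n.+1%:R @[n --> \oo] --> l.
  move=> GC; apply/cvgrPdist_le => e e0.
  have : (fun n => C * n.+1%:R^-1) @ \oo --> C * 0.
    by apply: cvgM; [exact: cvg_cst|exact: cvg_harmonic].
  rewrite mulr0 => /cvgr0Pnorm_le/(_ _ e0); apply: filterS => n.
  apply: le_trans; apply: le_trans (ler_norm _); rewrite distrC.
  rewrite ler_pdivlMr//; apply: le_trans (GC n.+1%:R _) => //.
  by rewrite ler_wpM2l// ler_eXnr// ?ler1n.
have l0 : F n.+1%:R - F (- n.+1%:R) @[n --> \oo] --> L - L'.
  by apply: cvgB; [exact: decay|exact: (decay (fun x => F (- x)))].
exact: (cvg_unique _ l1 l0).
Qed.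

Lemma Rintegral_derivative_eq0 F f (C : R) :
  (forall x : R, is_derive x 1 F (f x)) -> continuous f ->
  mu.-integrable setT (EFin \o f) ->
  (forall x, `|F x| * x ^+ 2 <= C) -> \int[mu]_x f x = 0.
Proof.
move=> dF cf fi FC; rewrite (Rintegral_derivative F f 0 0 C) ?subr0// => x _.
  by rewrite subr0.
by rewrite subr0 -(sqrrN x).
Qed.
End integration_tools.

(** * Hyperbolic functions, and domination by sech and by Gaussians *)

Section hyperbolic.
Context {R : realType}.
Implicit Types x y c : R.

Lemma coshN x : cosh (- x) = cosh x.
Proof. by rewrite /cosh opprK addrC. Qed.

Lemma sinhN x : sinh (- x) = - sinh x.
Proof. by rewrite /sinh opprK; field. Qed.

Lemma cosh0 : cosh (0 : R) = 1.
Proof. by rewrite /cosh oppr0 expR0; field. Qed.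

Lemma sinh0 : sinh (0 : R) = 0.
Proof. by rewrite /sinh oppr0 subrr mul0r. Qed.

Lemma cosh_gt0 x : 0 < cosh x.
Proof. by rewrite divr_gt0// addr_gt0// expR_gt0. Qed.

Lemma cosh_ge0 x : 0 <= cosh x.
Proof. exact/ltW/cosh_gt0. Qed.

Lemma cosh_neq0 x : cosh x != 0.
Proof. by rewrite gt_eqF// cosh_gt0. Qed.

Lemma coshD x y : cosh (x + y) = cosh x * cosh y + sinh x * sinh y.
Proof. by rewrite /cosh /sinh opprD !expRD; field. Qed.

Lemma sinhD x y : sinh (x + y) = sinh x * cosh y + cosh x * sinh y.
Proof. by rewrite /cosh /sinh opprD !expRD; field. Qed.

Lemma cosh2_sinh2 x : cosh x ^+ 2 = 1 + sinh x ^+ 2.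
Proof.
have := expRxMexpNx_1 x; rewrite /cosh /sinh => e1.
by rewrite -[X in _ = X + _]e1; field.
Qed.

Lemma cosh_double x : cosh x = 1 + 2 * sinh (x / 2) ^+ 2.
Proof.
rewrite {1}(_ : x = x / 2 + x / 2); last by field.
by rewrite coshD -!expr2 cosh2_sinh2; ring.
Qed.

Lemma cosh_ge1 x : 1 <= cosh x.
Proof. by rewrite cosh_double lerDl mulr_ge0// sqr_ge0. Qed.

Lemma expR_le_cosh x : expR x <= 2 * cosh x.
Proof. by rewrite /cosh mulrCA divff// mulr1 lerDl expR_ge0. Qed.

Lemma expRabs_le_cosh x : expR `|x| <= 2 * cosh x.
Proof.
by have [_|_] := ger0P x; rewrite ?expR_le_cosh// -coshN expR_le_cosh.
Qed.

Lemma norm_sinh_le x : `|sinh x| <= cosh x.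
Proof.
rewrite /sinh /cosh ler_norml -subr_ge0 -[X in _ && X]subr_ge0.
have := expR_ge0 x; have := expR_ge0 (- x) => ? ?.
by apply/andP; split; lra.
Qed.

Lemma norm_le_cosh x : `|x| <= 2 * cosh x.
Proof.
apply: le_trans (expRabs_le_cosh x); apply: le_trans (expR_ge1Dx _).
by rewrite lerDr.
Qed.

(** From exp |x| >= 1 + x ^ 2 / 2; the constant is not optimal. *)
Lemma sqr_le_cosh x : x ^+ 2 <= 4 * cosh x.
Proof.
have := expRabs_le_cosh x; have := @expR_ge1Dxn R `|x| 1 (normr_ge0 _).
rewrite real_normK ?num_real// (_ : 2`!%N = 2%N)// => h1 h2.
have := le_trans h1 h2; lra.
Qed.

Lemma sinh_ge_half x : 0 <= x -> x / 2 <= sinh x.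
Proof.
move=> x0; rewrite /sinh ler_pM2r ?invr_gt0//.
have := expR_ge1Dx x; have : expR (- x) <= 1 by rewrite expR_le1 oppr_le0.
lra.
Qed.

(** The optimal constant is 1; only the order of growth matters below. *)
Lemma sqr_le_sinh2 x : x ^+ 2 <= 4 * sinh x ^+ 2.
Proof.
wlog x0 : x / 0 <= x => [H|].
  have [/H//|x0] := leP 0 x.
  by have := H (- x); rewrite sinhN !sqrrN oppr_ge0; apply; exact: ltW.
have := sinh_ge_half x x0 => h.
rewrite -subr_ge0 (_ : _ - _ = (2 * sinh x - x) * (2 * sinh x + x)); last by ring.
by rewrite mulr_ge0//; lra.
Qed.

Lemma sinh_gt0 x : 0 < x -> 0 < sinh x.
Proof.
by move=> x0; apply: lt_le_trans (sinh_ge_half _ (ltW x0)); rewrite divr_gt0.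
Qed.

End hyperbolic.

Section integrability.
Context {R : realType}.
Notation mu := (@lebesgue_measure R).

Lemma integrable_scale D (c : R) (f : R -> R) : measurable D ->
  mu.-integrable D (EFin \o f) ->
  mu.-integrable D (EFin \o (fun x => c * f x)).
Proof. by move=> mD /(integrableZl mD c). Qed.

Lemma integrable_sub D (f g : R -> R) : measurable D ->
  mu.-integrable D (EFin \o f) -> mu.-integrable D (EFin \o g) ->
  mu.-integrable D (EFin \o (fun x => f x - g x)).
Proof. by move=> mD fi gi; exact: (integrableB mD fi gi). Qed.

(** Comparison with the derivative of the arctangent. *)
Lemma integrable_sech :
  mu.-integrable setT (EFin \o (fun x : R => (cosh x)^-1)).
Proof.
have c1 : continuous (fun x : R => (oneDsqr x)^-1).
  exact: continuous_oneDsqrV.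
have p1 x : 0 <= (oneDsqr x)^-1 :> R by rewrite invr_ge0 (le_trans ler01).
have i1 : mu.-integrable setT (EFin \o (fun x : R => (oneDsqr x)^-1)).
  apply/integrableP; split.
    by apply/measurable_EFinP; exact: continuous_measurable_fun.
  under eq_integral do rewrite /= ger0_norm//.
  rewrite ge0_integral_even//.
  - rewrite integral_itv_obnd_cbnd; last first.
      apply/measurable_EFinP/measurable_funTS.
      by exact: continuous_measurable_fun.
    by rewrite integral0y_oneDsqr -EFinM ltry.
  - by move=> x; rewrite /oneDsqr sqrrN.
apply: (continuous_integrable_le _ _ _ (integrable_scale _ 5 _ measurableT i1)).
  by cont => //; exact: cosh_neq0.
move=> x; rewrite ger0_norm ?invr_ge0 ?cosh_ge0//.
rewrite ler_pdivlMr ?(lt_le_trans ltr01)// mulrC ler_pdivrMr ?cosh_gt0//.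
by rewrite /oneDsqr; have := sqr_le_cosh x; have := cosh_ge1 x; lra.
Qed.

(** Completing the square turns the integrand into a multiple of the normal density
of mean c / t and variance 1 / t. *)
Lemma gauss_exp_integral (t c : R) : 0 < t ->
  let g x := expR (- (t / 2 * x ^+ 2)) * expR (c * x) in
  mu.-integrable setT (EFin \o g) /\
  \int[mu]_x g x = expR (c ^+ 2 / (2 * t)) * Num.sqrt (2 * pi / t).
Proof.
move=> t0 g; pose s := (Num.sqrt t)^-1.
have s0 : s != 0 by rewrite invr_eq0 gt_eqF// sqrtr_gt0.
have s2 : s ^+ 2 = t^-1 by rewrite exprVn sqr_sqrtr// ltW.
pose k := expR (c ^+ 2 / (2 * t)) * Num.sqrt (2 * pi / t).
have gE : g = fun x => k * normal_pdf (c / t) s x.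
  apply/funext => x; rewrite normal_pdfE//= /normal_peak /normal_fun s2.
  rewrite (_ : (t^-1 * pi *+ 2) = 2 * pi / t); last by rewrite -mulr_natl; ring.
  rewrite /k /g !mulrA mulfK; last first.
    by rewrite gt_eqF// sqrtr_gt0 divr_gt0// mulr_gt0// pi_gt0.
  rewrite -!expRD; congr expR; rewrite -mulr_natl; field; lra.
have ip := integrable_normal_pdf (c / t) s.
have := integral_normal_pdf (c / t) s.
rewrite gE; split; first exact: integrable_scale.
rewrite RintegralZl// /Rintegral.
by rewrite H /= mulr1.
Qed.

Lemma integrable_gauss_exp (t c : R) : 0 < t ->
  mu.-integrable setT
    (EFin \o (fun x => expR (- (t / 2 * x ^+ 2)) * expR (c * x))).
Proof. by move=> /gauss_exp_integral-/(_ c)[]. Qed.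

Lemma integrable_gauss_cosh (t c : R) : 0 < t ->
  mu.-integrable setT
    (EFin \o (fun x => expR (- (t / 2 * x ^+ 2)) * cosh (c * x))).
Proof.
move=> t0; have i1 := integrable_gauss_exp t c t0.
have i2 := integrable_gauss_exp t (- c) t0.
have := integrable_scale _ 2^-1 _ measurableT (integrableD measurableT i1 i2).
apply: eq_integrable => // x _ /=; congr EFin.
by rewrite /cosh mulNr; field.
Qed.

Lemma integral_gauss (t : R) : 0 < t ->
  \int[mu]_x expR (- (t / 2 * x ^+ 2)) = Num.sqrt (2 * pi / t).
Proof.
move=> /gauss_exp_integral-/(_ 0)[_].
rewrite expr0n/= mul0r expR0 mul1r => <-.
by apply: eq_Rintegral => x _; rewrite mul0r expR0 mulr1.
Qed.

(** It is enough that the derivative is dominated on a neighbourhood of a, here the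
interval of radius 1. *)
Lemma is_derive_under_integral (f df : R -> R -> R) (G : R -> R) (a : R) :
  (forall x, mu.-integrable setT (EFin \o f x)) ->
  (forall x y : R, is_derive x 1 (f ^~ y) (df x y)) ->
  mu.-integrable setT (EFin \o G) ->
  (forall x y : R, a - 1 < x < a + 1 -> `|df x y| <= G y) ->
  is_derive a 1 (fun x => \int[mu]_y f x y) (\int[mu]_y df a y).
Proof.
move=> fi fdf Gi dfG.
have d1E x y : partial1of2 f x y = df x y.
  by rewrite partial1of2E; case: (fdf x y).
have Ia : `]a - 1, a + 1[%classic a.
  by rewrite /= in_itv/= ltrBlDr ltrDl ltr01.
have der1 (x y : R) : `]a - 1, a + 1[%classic x -> setT y ->
  derivable (f ^~ y) x 1 by move=> _ _; case: (fdf x y).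
have G0 y : 0 <= G y.
  by apply: le_trans (dfG a y _) => //; move: Ia; rewrite /= in_itv.
have Gub (x y : R) : `]a - 1, a + 1[%classic x -> setT y ->
  `|partial1of2 f x y| <= G y.
  by rewrite /= in_itv/= => xa _; rewrite d1E; exact: dfG.
constructor.
  exact: (@derivable_under_integral _ _ _ mu f setT measurableT a _ _ Ia
    (fun x _ => fi x) der1 G G0 Gi Gub).
rewrite -derive1E (@differentiation_under_integral _ _ _ mu f setT measurableT
  a _ _ Ia (fun x _ => fi x) der1 G G0 Gi Gub).
by apply: eq_Rintegral => y _; exact: d1E.
Qed.

End integrability.

(** * Fubini on rectangles *)

Section fubini_on_rectangles.
Context {R : realType}.
Notation mu := (@lebesgue_measure R).
Implicit Types (D : set R).
Local Open Scope ereal_scope.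

(** Extending by zero reduces integrals over rectangles to integrals over the whole
plane. *)
Lemma iterated_integral_restrict D1 D2 (h : R * R -> \bar R) :
  \int[mu]_x \int[mu]_y (h \_ (D1 `*` D2)) (x, y) =
  \int[mu]_(x in D1) \int[mu]_(y in D2) h (x, y).
Proof.
rewrite [RHS]integral_mkcond; apply: eq_integral => x _; rewrite [RHS]patchE.
case: ifPn => xD1.
  rewrite [RHS]integral_mkcond; apply: eq_integral => y _.
  by rewrite !patchE in_setX xD1.
by apply: integral0_eq => y _; rewrite patchE in_setX (negbTE xD1).
Qed.

Lemma iterated_integral_restrict21 D1 D2 (h : R * R -> \bar R) :
  \int[mu]_y \int[mu]_x (h \_ (D1 `*` D2)) (x, y) =
  \int[mu]_(y in D2) \int[mu]_(x in D1) h (x, y).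
Proof.
rewrite [RHS]integral_mkcond; apply: eq_integral => y _; rewrite [RHS]patchE.
case: ifPn => yD2.
  rewrite [RHS]integral_mkcond; apply: eq_integral => x _.
  by rewrite !patchE in_setX yD2 andbT.
by apply: integral0_eq => x _; rewrite patchE in_setX (negbTE yD2) andbF.
Qed.

Lemma tonelli_on D1 D2 (f : R -> R -> R) : measurable D1 -> measurable D2 ->
  measurable_fun setT (fun z : R * R => f z.1 z.2) ->
  (forall x y, 0 <= f x y)%R ->
  \int[mu]_(x in D1) \int[mu]_(y in D2) (f x y)%:E =
  \int[mu]_(y in D2) \int[mu]_(x in D1) (f x y)%:E.
Proof.
move=> mD1 mD2 mf f0.
pose h (z : R * R) := (f z.1 z.2)%:E.
have mD : measurable (D1 `*` D2) by exact: measurableX.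
have mh : measurable_fun setT (h \_ (D1 `*` D2)).
  apply/(measurable_restrictT _ _).1 => //; apply: measurable_funTS.
  exact/measurable_EFinP.
rewrite -(iterated_integral_restrict _ _ h) -(iterated_integral_restrict21 _ _ h).
have h0 z : 0 <= (h \_ (D1 `*` D2)) z.
  by rewrite patchE; case: ifPn => // _; rewrite /h lee_fin.
exact: (@fubini_tonelli _ _ _ _ R mu mu _ mh h0).
Qed.

Lemma measurable_integral_on D1 D2 (f : R -> R -> R) :
  measurable D1 -> measurable D2 ->
  measurable_fun setT (fun z : R * R => f z.1 z.2) ->
  (forall x y, 0 <= f x y)%R ->
  measurable_fun D1 (fun x => \int[mu]_(y in D2) (f x y)%:E).
Proof.
move=> mD1 mD2 mf f0.
pose h (z : R * R) := (f z.1 z.2)%:E.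
have mh : measurable_fun setT (h \_ (setT `*` D2)).
  apply/(measurable_restrictT _ _).1; first exact: measurableX.
  by apply: measurable_funTS; exact/measurable_EFinP.
have h0 z : 0 <= (h \_ (setT `*` D2)) z.
  by rewrite patchE; case: ifPn => // _; rewrite /h lee_fin.
have := @measurable_fun_fubini_tonelli_F _ _ _ _ R mu _ mh h0.
move=> /(@measurable_funTS _ _ _ _ D1); apply: eq_measurable_fun => x _.
rewrite /fubini_F [RHS]integral_mkcond; apply: eq_integral => y _.
by rewrite !patchE in_setX in_setT.
Qed.

(** The integrability of the sections lets the interchange be stated between
real-valued integrals, and the integrability of the inner integral allows one to
go back to extended-real integrals. *)
Lemma fubini_on D1 D2 (f : R -> R -> R) : measurable D1 -> measurable D2 ->
  measurable_fun setT (fun z : R * R => f z.1 z.2) ->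
  \int[mu]_(x in D1) \int[mu]_(y in D2) `|f x y|%:E < +oo ->
  (forall x, D1 x -> mu.-integrable D2 (EFin \o f x)) ->
  (forall y, D2 y -> mu.-integrable D1 (EFin \o f ^~ y)) ->
  mu.-integrable D1 (EFin \o (fun x => \int[mu]_(y in D2) f x y)%R) /\
  (\int[mu]_(x in D1) \int[mu]_(y in D2) f x y =
   \int[mu]_(y in D2) \int[mu]_(x in D1) f x y)%R.
Proof.
move=> mD1 mD2 mf foo fi1 fi2.
pose h (z : R * R) := (f z.1 z.2)%:E.
have mD : measurable (D1 `*` D2) by exact: measurableX.
have mh : measurable_fun setT (h \_ (D1 `*` D2)).
  apply/(measurable_restrictT _ _).1 => //; apply: measurable_funTS.
  exact/measurable_EFinP.
have ih : (mu \x mu).-integrable setT (h \_ (D1 `*` D2)).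
  apply: (@integrable12ltyP _ _ _ _ R mu mu _ mh).2.
  rewrite (_ : integral _ _ _ =
    \int[mu]_(x in D1) \int[mu]_(y in D2) `|f x y|%:E) //.
  rewrite -(iterated_integral_restrict _ _ (fun z => `|f z.1 z.2|%:E)).
  apply: eq_integral => x _; apply: eq_integral => y _; rewrite !patchE.
  by case: ifP => //; rewrite abse0.
split.
  have /= := integrable_fubini_F ih.
  move=> /(@integrableS _ _ _ mu setT D1 _ measurableT mD1 (@subsetT _ _)).
  apply: eq_integrable => // x xD1; rewrite /fubini_F /=.
  rewrite Rintegral_EFin//; last by apply: fi1; rewrite inE in xD1.
  rewrite [RHS]integral_mkcond; apply: eq_integral => y _.
  by rewrite !patchE in_setX xD1.
congr fine.
transitivity (\int[mu]_(x in D1) \int[mu]_(y in D2) h (x, y)).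
  apply: eq_integral => x xD1; rewrite Rintegral_EFin//.
  by apply: fi1; rewrite inE in xD1.
transitivity (\int[mu]_(y in D2) \int[mu]_(x in D1) h (x, y)); last first.
  apply: eq_integral => y yD2; rewrite Rintegral_EFin//.
  by apply: fi2; rewrite inE in yD2.
rewrite -iterated_integral_restrict -iterated_integral_restrict21.
exact: Fubini.
Qed.

End fubini_on_rectangles.

Section product_domination.
Context {R : realType}.
Notation mu := (@lebesgue_measure R).

(** A bound by a product of integrable functions gives at once the finiteness of the
double integral and the integrability of all sections. *)
Lemma fubini_dominated (D1 D2 : set R) (f : R -> R -> R) (a b : R -> R) :
  measurable D1 -> measurable D2 ->
  measurable_fun setT (fun z : R * R => f z.1 z.2) ->
  mu.-integrable D1 (EFin \o a) -> mu.-integrable D2 (EFin \o b) ->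
  (forall x, D1 x -> 0 <= a x) -> (forall y, D2 y -> 0 <= b y) ->
  (forall x y, D1 x -> D2 y -> `|f x y| <= a x * b y) ->
  mu.-integrable D1 (EFin \o (fun x => \int[mu]_(y in D2) f x y)) /\
  \int[mu]_(x in D1) \int[mu]_(y in D2) f x y =
  \int[mu]_(y in D2) \int[mu]_(x in D1) f x y.
Proof.
move=> mD1 mD2 mf ia ib a0 b0 fab.
have m1 x : measurable_fun setT (f x).
  exact: (measurableT_comp mf (measurable_pair1 x)).
have m2 y : measurable_fun setT (f ^~ y).
  exact: (measurableT_comp mf (measurable_pair2 y)).
apply: fubini_on => //.
- set B := \int[mu]_(y in D2) b y.
  have mb : measurable_fun D2 (EFin \o b) by case/integrableP : ib.
  have ma : measurable_fun D1 (EFin \o a) by case/integrableP : ia.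
  have iaB : mu.-integrable D1 (EFin \o (fun x => B * a x)).
    exact: integrable_scale.
  apply: (@le_lt_trans _ _ (\int[mu]_(x in D1) (B * a x)%:E)%E); last first.
    by rewrite -Rintegral_EFin// ltry.
  apply: ge0_le_integral => //.
  + by move=> x _; apply: integral_ge0 => y _; rewrite lee_fin.
  + apply: (measurable_integral_on _ _ (fun x y => `|f x y|)) => //.
    exact: measurableT_comp.
  + exact: (measurable_int mu iaB).
  move=> x D1x.
  have iab := integrable_scale _ (a x) _ mD2 ib.
  apply: (@le_trans _ _ (\int[mu]_(y in D2) (a x * b y)%:E)%E).
    apply: ge0_le_integral => //.
    + apply/measurable_EFinP; apply: measurable_funTS.
      exact: (meas_comp Num.norm (f x) (@norm_continuous _ _) (m1 x)).
    + exact: (measurable_int mu iab).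
    + by move=> y D2y; rewrite lee_fin fab.
  by rewrite -Rintegral_EFin// RintegralZl// mulrC.
- move=> x D1x; apply: (measurable_integrable_le _ _ _ mD2 _
    (integrable_scale _ (a x) _ mD2 ib)) => [|y D2y]; last exact: fab.
  exact: measurable_funTS.
- move=> y D2y; apply: (measurable_integrable_le _ _ _ mD1 _
    (integrable_scale _ (b y) _ mD1 ia)) => [|x D1x]; last first.
    by rewrite mulrC fab.
  exact: measurable_funTS.
Qed.

End product_domination.

(** * Fourier integrals of Gaussians *)

Section gaussian_transforms.
Context {R : realType}.
Notation mu := (@lebesgue_measure R).
Implicit Types t u c x : R.

Lemma norm_sin_le1 (a b : R) : 0 <= a -> `|a * sin b| <= a.
Proof. by move=> a0; rewrite normrM ger0_norm// ler_piMr// sin_max. Qed.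

Lemma norm_cos_le1 (a b : R) : 0 <= a -> `|a * cos b| <= a.
Proof. by move=> a0; rewrite normrM ger0_norm// ler_piMr// cos_max. Qed.

Lemma integrable_gauss t : 0 < t ->
  mu.-integrable setT (EFin \o (fun x => expR (- (t / 2 * x ^+ 2)))).
Proof.
move=> t0; have := integrable_gauss_exp t 0 t0; apply: eq_integrable => // x _.
by rewrite /= mul0r expR0 mulr1.
Qed.

(** As a function F of u, the integral satisfies F' = - (u / t) F: differentiate
under the integral, then integrate by parts.  Hence F(u) exp (u ^ 2 / (2 t)) is
constant. *)
Lemma integral_gauss_cos t u : 0 < t ->
  \int[mu]_x (expR (- (t / 2 * x ^+ 2)) * cos (u * x)) =
  Num.sqrt (2 * pi / t) * expR (- (u ^+ 2 / (2 * t))).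
Proof.
move=> t0; pose w x := expR (- (t / 2 * x ^+ 2)).
have t0' : t != 0 by rewrite gt_eqF.
have iw : mu.-integrable setT (EFin \o w) := integrable_gauss t t0.
(* The factor x that differentiation produces is absorbed by 2 cosh x. *)
pose W x := 2 * (expR (- (t / 2 * x ^+ 2)) * cosh (1 * x)).
have iW : mu.-integrable setT (EFin \o W).
  exact: integrable_scale (integrable_gauss_cosh t 1 t0).
have wW (x s : R) : `|s| <= 1 -> `|w x * (x * s)| <= W x.
  move=> s1; rewrite /W mul1r [leRHS]mulrCA normrM ger0_norm ?expR_ge0//.
  rewrite ler_wpM2l ?expR_ge0// (le_trans _ (norm_le_cosh x))// normrM.
  by rewrite ler_piMr.
have ic v : mu.-integrable setT (EFin \o (fun x => w x * cos (v * x))).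
  apply: continuous_integrable_le iw _; first by rewrite /w; cont.
  by move=> x; rewrite norm_cos_le1 ?expR_ge0.
have is_ v : mu.-integrable setT (EFin \o (fun x => w x * (x * sin (v * x)))).
  apply: continuous_integrable_le iW _; first by rewrite /w; cont.
  by move=> x; rewrite wW ?sin_max.
pose F v := \int[mu]_x (w x * cos (v * x)).
have FE v : \int[mu]_x (w x * (x * sin (v * x))) = v / t * F v.
  have : \int[mu]_x (v * (w x * cos (v * x)) -
      t * (w x * (x * sin (v * x)))) = 0.
    apply: (Rintegral_derivative_eq0 (fun x => w x * sin (v * x)) _ (2 / t)).
    - move=> x; rewrite /w; isder.
      by rewrite /=; field.
    - by rewrite /w; cont.
    - have i1 := integrable_scale _ v _ measurableT (ic v).
      have i2 := integrable_scale _ t _ measurableT (is_ v).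
      exact: (integrableB measurableT i1 i2).
    - move=> x; apply: (@le_trans _ _ (w x * x ^+ 2)).
        by rewrite ler_wpM2r ?sqr_ge0// norm_sin_le1 ?expR_ge0.
      rewrite /w expRN mulrC ler_pdivrMr ?expR_gt0//.
      apply: (@le_trans _ _ (2 / t * (1 + t / 2 * x ^+ 2))).
        rewrite (_ : _ * _ = 2 / t + x ^+ 2); last by field.
        by rewrite lerDr divr_ge0// ltW.
      by rewrite ler_wpM2l ?expR_ge1Dx// divr_ge0// ltW.
  have i1 := integrable_scale _ v _ measurableT (ic v).
  have i2 := integrable_scale _ t _ measurableT (is_ v).
  rewrite RintegralB// !RintegralZl// => /eqP; rewrite subr_eq0 => /eqP.
  by rewrite mulrAC => ->; rewrite mulrAC divff// mul1r.
have dF v : is_derive v (1 : R) F (- (v / t * F v)).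
  rewrite -FE -mulN1r -RintegralZl//.
  apply: (is_derive_under_integral (fun v x => w x * cos (v * x))
    (fun v x => -1 * (w x * (x * sin (v * x)))) W) => //.
    move=> a x; isder.
    by rewrite /=; ring.
  by move=> a x _; rewrite normrM normrN1 mul1r wW// sin_max.
have dH v : is_derive v (1 : R) (fun v => F v * expR (v ^+ 2 / (2 * t))) 0.
  have e1 : is_derive v 1 (fun v => expR (v ^+ 2 / (2 * t)))
      (expR (v ^+ 2 / (2 * t)) * (v / t)).
    by isder; rewrite /=; field.
  apply: (is_derive_eq (derive_mul F _ _ _ _ (dF v) e1)).
  by rewrite /=; field.
have := is_derive_0_is_cst u 0 dH.
have -> : F 0 = Num.sqrt (2 * pi / t).
  rewrite -integral_gauss//; apply: eq_Rintegral => x _.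
  by rewrite mul0r cos0 mulr1.
rewrite expr0n /= mul0r expR0 mulr1 => <-.
by rewrite -mulrA -expRD subrr expR0 mulr1.
Qed.

(** Completing the square, the Gaussian times exp (c x) and exp (- c x) become
translates by c / t and - c / t.  Translating back moves the shifts into the
sine, and sin (u (x + m)) - sin (u (x - m)) = 2 cos (u x) sin (u m). *)
Lemma integral_gauss_sinh_sin t c u : 0 < t ->
  \int[mu]_(x in `]0, +oo[)
    (expR (- (t / 2 * x ^+ 2)) * sinh (c * x) * sin (u * x)) =
  Num.sqrt (2 * pi / t) / 2 * expR ((c ^+ 2 - u ^+ 2) / (2 * t)) *
    sin (c * u / t).
Proof.
move=> t0; pose w x := expR (- (t / 2 * x ^+ 2)).
have t0' : t != 0 by rewrite gt_eqF.
have iw : mu.-integrable setT (EFin \o w) := integrable_gauss t t0.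
have igc := integrable_gauss_cosh t c t0.
have ii : mu.-integrable setT (EFin \o (fun x =>
    expR (- (t / 2 * x ^+ 2)) * sinh (c * x) * sin (u * x))).
  apply: continuous_integrable_le igc _; first by cont.
  move=> x; rewrite -mulrA normrM ger0_norm ?expR_ge0// ler_wpM2l ?expR_ge0//.
  by rewrite normrM (le_trans _ (norm_sinh_le _))// ler_piMr ?sin_max.
rewrite Rintegral_even//; [|by cont|].
  2: by move=> x; rewrite sqrrN !mulrN sinhN sinN; ring.
have is_ v : mu.-integrable setT (EFin \o (fun x => w x * sin (u * (x + v)))).
  apply: continuous_integrable_le iw _; first by rewrite /w; cont.
  by move=> x; rewrite norm_sin_le1 ?expR_ge0.
have cs v : continuous (fun x => w x * sin (u * (x + v))) by rewrite /w; cont.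
pose m := c / t; pose k := expR (c ^+ 2 / (2 * t)) / 2.
have s1 := integrable_shift _ (- m) (cs m) (is_ m).
have s2 := integrable_shift _ m (cs (- m)) (is_ (- m)).
have wk s x : s ^+ 2 = 1 -> expR (- (t / 2 * x ^+ 2)) * expR (s * (c * x)) =
    2 * k * w (x - s * m).
  move=> s2E; have -> : 2 * k = expR (c ^+ 2 / (2 * t)) by rewrite /k; field.
  rewrite -!expRD; congr expR.
  by rewrite sqrrB exprMn s2E /m; field.
transitivity ((\int[mu]_x (k * (w (x - m) * sin (u * (x - m + m)) -
    w (x + m) * sin (u * (x + m - m))))) / 2).
  congr (_ / 2); apply: eq_Rintegral => x _; rewrite subrK addrK.
  have := wk 1 x (expr1n _ _); have := wk (-1) x (ltac:(by rewrite sqrrN expr1n)).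
  rewrite !mulN1r !mul1r opprK /sinh => h1 h2.
  transitivity ((2 * k * w (x - m) - 2 * k * w (x + m)) / 2 * sin (u * x)).
    by rewrite -h1 -h2; field.
  by field.
rewrite RintegralZl//; last exact: (integrableB measurableT s1 s2).
rewrite RintegralB//.
rewrite (Rintegral_shift (fun x => w x * sin (u * (x + m))))//.
rewrite (Rintegral_shift (fun x => w x * sin (u * (x - m))))//.
rewrite -RintegralB//.
have ic : mu.-integrable setT (EFin \o (fun x => w x * cos (u * x))).
  apply: continuous_integrable_le iw _; first by rewrite /w; cont.
  by move=> x; rewrite norm_cos_le1 ?expR_ge0.
transitivity (k * (\int[mu]_x (2 * sin (c * u / t) * (w x * cos (u * x)))) / 2).
  congr (_ * _ / _); apply: eq_Rintegral => x _.
  have -> : c * u / t = u * m by rewrite /m; ring.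
  by rewrite mulrBr mulrDr sinD sinB; ring.
rewrite RintegralZl// integral_gauss_cos//.
rewrite (_ : (c ^+ 2 - u ^+ 2) / (2 * t) = c ^+ 2 / (2 * t) - u ^+ 2 / (2 * t)).
  by rewrite expRD /k; field.
by field.
Qed.

End gaussian_transforms.

(** * Powers of sech: recurrence in the exponent *)

Section sech_squared.
Context {R : realType}.
Notation mu := (@lebesgue_measure R).
Implicit Types tau x s : R.

(** The square of sech (s / 2).  Together with tanh (s / 2) it is closed under
differentiation, so no other function enters the computations with its powers. *)
Definition sech2 s : R := (cosh (s / 2) ^+ 2)^-1.

Lemma sech2_ge0 s : 0 <= sech2 s.
Proof. by rewrite invr_ge0 sqr_ge0. Qed.

Lemma cosh_half_sqr_neq0 s : cosh (s / 2) ^+ 2 != 0.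
Proof. by rewrite expf_neq0// cosh_neq0. Qed.

Lemma continuous_sech2 : continuous sech2.
Proof. by rewrite /sech2; cont; exact: cosh_half_sqr_neq0. Qed.

Lemma sech2E s : sech2 s = 2 / (1 + cosh s).
Proof.
have h1 := cosh_half_sqr_neq0 s; have h2 : 1 + cosh s != 0.
  by rewrite gt_eqF// addr_gt0// cosh_gt0.
rewrite /sech2; apply: (mulfI h1); rewrite divff//.
apply: (mulIf h2); rewrite mul1r mulrA divfK//.
by rewrite cosh2_sinh2 cosh_double; ring.
Qed.

Lemma sech2_le s : sech2 s <= 2 * (cosh s)^-1.
Proof.
rewrite sech2E ler_pM2l// lef_pV2 ?posrE ?cosh_gt0//; first by rewrite lerDr.
by rewrite addr_gt0// cosh_gt0.
Qed.

Lemma sech2_le1 s : sech2 s <= 1.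
Proof. by rewrite invf_le1 ?exprn_gt0 ?cosh_gt0// exprn_ege1// cosh_ge1. Qed.

Lemma sech2_pow_le s n : sech2 s ^+ n.+1 <= sech2 s.
Proof. by rewrite exprS ler_piMr ?sech2_ge0// exprn_ile1 ?sech2_ge0 ?sech2_le1. Qed.

Lemma sech2_sqr s : sech2 s * s ^+ 2 <= 8.
Proof.
apply: le_trans (ler_wpM2r (sqr_ge0 _) (sech2_le s)) _.
by rewrite mulrAC ler_pdivrMr ?cosh_gt0//; have := sqr_le_cosh s; lra.
Qed.

Lemma integrable_sech2 : mu.-integrable setT (EFin \o sech2).
Proof.
apply: continuous_integrable_le continuous_sech2
  (integrable_scale _ 2 _ measurableT integrable_sech) _ => s.
by rewrite ger0_norm ?sech2_ge0// sech2_le.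
Qed.

Definition tanh_half s : R := sinh (s / 2) / cosh (s / 2).

Lemma tanh_half_sqr s : tanh_half s ^+ 2 = 1 - sech2 s.
Proof.
rewrite /tanh_half expr_div_n /sech2; apply: (mulIf (cosh_half_sqr_neq0 s)).
by rewrite mulrBl divfK ?cosh_half_sqr_neq0// mulVf ?cosh_half_sqr_neq0// mul1r
  cosh2_sinh2; ring.
Qed.

Lemma tanh_halfN s : tanh_half (- s) = - tanh_half s.
Proof. by rewrite /tanh_half mulNr coshN sinhN mulNr. Qed.

Lemma tanh_half_norm_le1 s : `|tanh_half s| <= 1.
Proof.
by rewrite normrM normfV (ger0_norm (cosh_ge0 _)) ler_pdivrMr ?cosh_gt0// mul1r
  norm_sinh_le.
Qed.

Lemma is_derive_tanh_half s :
  is_derive s (1 : R) tanh_half (sech2 s / 2).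
Proof.
rewrite /tanh_half; isder; first exact: cosh_neq0.
rewrite /sech2.
have h := cosh_half_sqr_neq0 s; have h1 := cosh_neq0 (s / 2).
apply: (mulIf h).
transitivity ((cosh (s / 2) ^+ 2 - sinh (s / 2) ^+ 2) / 2).
  by field.
rewrite mulrAC mulVf// cosh2_sinh2; ring.
Qed.

Lemma is_derive_sech2 s :
  is_derive s (1 : R) sech2 (- (tanh_half s * sech2 s)).
Proof.
rewrite /sech2; isder; first exact: cosh_half_sqr_neq0.
by rewrite /tanh_half /sech2 /=; field; exact: cosh_neq0.
Qed.

(** The primitive 2 tanh (s / 2) tends to its limits at the rate of sech2, since
1 - T <= 1 - T ^ 2 for 0 <= T <= 1. *)
Lemma integral_sech2 : \int[mu]_s sech2 s = 4.
Proof.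
rewrite (_ : 4 = 2 - (- 2)); last by lra.
apply: (Rintegral_derivative (fun s => 2 * tanh_half s) sech2 2 (- 2) 16).
- move=> s; have d := is_derive_tanh_half s.
  apply: (is_derive_eq (derive_mul _ _ _ _ _ (derive_cst 2 _) d)).
  by field.
- exact: continuous_sech2.
- exact: integrable_sech2.
- move=> s s0.
  have T0 : 0 <= tanh_half s.
    by rewrite divr_ge0 ?cosh_ge0// (le_trans _ (sinh_ge_half _ _)) ?divr_ge0.
  have T1 := tanh_half_norm_le1 s; rewrite ger0_norm// in T1.
  have qT : 1 - tanh_half s <= sech2 s.
    by have := tanh_half_sqr s; nra.
  rewrite distrC ger0_norm; last by lra.
  have := sech2_sqr s; have := sqr_ge0 s; nra.
- move=> s s0; rewrite tanh_halfN mulrN opprK.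
  have T0 : 0 <= tanh_half s.
    by rewrite divr_ge0 ?cosh_ge0// (le_trans _ (sinh_ge_half _ _)) ?divr_ge0.
  have T1 := tanh_half_norm_le1 s; rewrite ger0_norm// in T1.
  have qT : 1 - tanh_half s <= sech2 s.
    by have := tanh_half_sqr s; nra.
  rewrite addrC ger0_norm; last by lra.
  have := sech2_sqr s; have := sqr_ge0 s; nra.
Qed.

Definition sech_moment tau n := \int[mu]_s (cos (tau * s) * sech2 s ^+ n).

Lemma continuous_sech_moment tau n :
  continuous (fun s => cos (tau * s) * sech2 s ^+ n).
Proof. by cont; exact: continuous_sech2. Qed.

Lemma integrable_sech_moment tau n :
  mu.-integrable setT (EFin \o (fun s => cos (tau * s) * sech2 s ^+ n.+1)).
Proof.
apply: continuous_integrable_le integrable_sech2 _.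
  exact: continuous_sech_moment.
move=> s; rewrite mulrC (le_trans (norm_cos_le1 _ _ _))//.
  by rewrite exprn_ge0 ?sech2_ge0.
exact: sech2_pow_le.
Qed.

(** Two integrations by parts: with T = tanh (s / 2), the second derivative of
sech2 ^ N is N ^ 2 sech2 ^ N - N (N + 1 / 2) sech2 ^ (N + 1). *)
Lemma sech_moment_rec tau n :
  (n.+1%:R ^+ 2 + tau ^+ 2) * sech_moment tau n.+1 =
  n.+1%:R * (n.+1%:R + 2^-1) * sech_moment tau n.+2.
Proof.
have i1 := integrable_scale _ (n.+1%:R ^+ 2 + tau ^+ 2) _ measurableT
  (integrable_sech_moment tau n).
have i2 := integrable_scale _ (n.+1%:R * (n.+1%:R + 2^-1)) _ measurableT
  (integrable_sech_moment tau n.+1).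
apply/eqP; rewrite -subr_eq0 -!RintegralZl//; last 2 first.
  exact: integrable_sech_moment.
  exact: integrable_sech_moment.
rewrite -RintegralB//; apply/eqP.
apply: (Rintegral_derivative_eq0 (fun s =>
  cos (tau * s) * (- (n.+1%:R * (tanh_half s * sech2 s ^+ n.+1))) +
  tau * (sin (tau * s) * sech2 s ^+ n.+1))
  (fun s => (n.+1%:R ^+ 2 + tau ^+ 2) * (cos (tau * s) * sech2 s ^+ n.+1) -
    n.+1%:R * (n.+1%:R + 2^-1) * (cos (tau * s) * sech2 s ^+ n.+2))
  ((n.+1%:R + `|tau|) * 8)).
- move=> s; have dT := is_derive_tanh_half s; have dq := is_derive_sech2 s.
  have TT := tanh_half_sqr s.
  isder; [exact: dT|exact: dq|exact: dq|].
  rewrite /=.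
  transitivity (cos (tau * s) *
    (n.+1%:R ^+ 2 * (tanh_half s ^+ 2) * sech2 s ^+ n.+1 -
     n.+1%:R / 2 * sech2 s ^+ n.+2 + tau ^+ 2 * sech2 s ^+ n.+1)).
    by rewrite !exprS; field.
  by rewrite TT !exprS; field.
- by cont; exact: continuous_sech2.
- exact: (integrableB measurableT i1 i2).
- move=> s.
  have q0 : 0 <= sech2 s ^+ n.+1 by rewrite exprn_ge0 ?sech2_ge0.
  apply: (@le_trans _ _ ((n.+1%:R + `|tau|) * sech2 s * s ^+ 2)); last first.
    by rewrite -mulrA ler_wpM2l ?addr_ge0// sech2_sqr.
  rewrite ler_wpM2r ?sqr_ge0//.
  apply: (@le_trans _ _ ((n.+1%:R + `|tau|) * sech2 s ^+ n.+1)); last first.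
    by rewrite ler_wpM2l ?addr_ge0// sech2_pow_le.
  rewrite mulrDl (le_trans (ler_normD _ _))// lerD//.
    rewrite mulrC mulNr normrN -mulrA normrM ger0_norm//.
    rewrite ler_wpM2l// mulrAC normrM [X in _ * X]ger0_norm// ler_piMl//.
    by rewrite normrM mulr_ile1// ?tanh_half_norm_le1 ?cos_max.
  by rewrite normrM ler_wpM2l// mulrC norm_sin_le1.
Qed.

End sech_squared.

(** * Powers of cosine: the mirror recurrence *)

Section cosine_moments.
Context {R : realType}.
Notation mu := (@lebesgue_measure R).
Implicit Types tau x y : R.

Lemma is_derive_mvt (f df : R -> R) x : 0 <= x ->
  (forall y : R, is_derive y 1 f (df y)) ->
  exists2 c, 0 <= c <= x & f x = f 0 + df c * x.
Proof.
move=> x0 fdf.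
have cf : {within `[0, x], continuous f}.
  exact/continuous_subspaceT/(is_derive_continuous f df).
have [c] := MVT_segment x0 (fun y _ => fdf y) cf.
by rewrite in_itv/= subr0 => cx h; exists c => //; rewrite -h; ring.
Qed.

Lemma norm_sin_le x : `|sin x| <= `|x|.
Proof.
wlog x0 : x / 0 <= x => [H|].
  have [/H//|x0] := leP 0 x.
  by have := H (- x); rewrite sinN !normrN oppr_ge0; apply; exact: ltW.
have d (y : R) : is_derive y 1 (fun z => sin z) (cos y).
  by isder; rewrite mulr1.
have [c _ ->] := is_derive_mvt sin cos x x0 d.
by rewrite sin0 add0r normrM ler_piMl// cos_max.
Qed.

Lemma one_sub_cos_le x : 1 - cos x <= x ^+ 2.
Proof.
have -> : 1 - cos x = 2 * sin (x / 2) ^+ 2.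
  rewrite {1}(_ : x = x / 2 + x / 2); last by field.
  by rewrite cosD -!expr2 cos2sin2; ring.
have := norm_sin_le (x / 2).
rewrite -ler_sqr ?nnegrE// !real_normK ?num_real// expr_div_n.
by have := sqr_ge0 x; lra.
Qed.

(** This bounds x ^ 2 cos x ^ 2 by 1 - cos x ^ 2, and so compares the second moment
of a power of the cosine with a difference of two consecutive powers. *)
Lemma mul_cos_le_sin x : 0 <= x <= pi / 2 -> x * cos x <= sin x.
Proof.
move=> /andP[x0 x1].
have d (y : R) : is_derive y 1 (fun z => sin z - z * cos z) (y * sin y).
  by isder; rewrite /=; ring.
have [c /andP[c0 c1]] := is_derive_mvt _ _ x x0 d.
rewrite sin0 mul0r subrr add0r -subr_ge0 => ->.
rewrite !mulr_ge0// sin_ge0_pi// c0/= (le_trans c1)// (le_trans x1)//.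
by rewrite ler_pdivrMr// ler_peMr ?pi_ge0// ler1n.
Qed.

Lemma cosh_sub_one_le x : 0 <= x -> cosh x - 1 <= x ^+ 2 * expR x.
Proof.
move=> x0.
have s : sinh (x / 2) <= x / 2 * expR (x / 2).
  rewrite /sinh ler_pdivrMr// -subr_ge0.
  have := expR_ge1Dx (- x); rewrite -(@ler_pM2l _ (expR (x / 2))) ?expR_gt0//.
  rewrite -expRD (_ : x / 2 + - x = - (x / 2)); last by field.
  lra.
have s0 : 0 <= sinh (x / 2).
  by rewrite (le_trans _ (sinh_ge_half _ _)) ?divr_ge0.
have e2 : expR x = expR (x / 2) ^+ 2.
  by rewrite expr2 -expRD; congr expR; field.
rewrite cosh_double e2; move: s s0; set S := sinh _; set E := expR _ => s s0.
have : S ^+ 2 <= (x / 2 * E) ^+ 2 by rewrite ler_sqr ?nnegrE// (le_trans s0).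
rewrite (_ : (x / 2 * E) ^+ 2 = (x * E) ^+ 2 / 4); last by field.
by have := sqr_ge0 (x * E); rewrite !exprMn; lra.
Qed.

Definition cos_moment tau n :=
  \int[mu]_(x in `[0, pi / 2]) (cosh (2 * tau * x) * cos x ^+ n.*2).

Lemma integrable_segment (f : R -> R) (a b : R) : continuous f ->
  mu.-integrable `[a, b] (EFin \o f).
Proof.
move=> cf; apply: continuous_compact_integrable; first exact: segment_compact.
exact: continuous_subspaceT.
Qed.

Lemma integral_segment_derivative (F f : R -> R) (a b : R) : a < b ->
  (forall x : R, is_derive x 1 F (f x)) -> continuous f ->
  \int[mu]_(x in `[a, b]) f x = F b - F a.
Proof.
move=> ab dF cf; have cF := is_derive_continuous F f dF.
rewrite /Rintegral (@continuous_FTC2 _ f F)//.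
- exact: continuous_subspaceT.
- split.
  + by move=> x _; case: (dF x).
  + by apply: cvg_at_right_filter; exact: cF.
  + by apply: cvg_at_left_filter; exact: cF.
- by move=> x _; rewrite derive1E; case: (dF x).
Qed.

Lemma pihalf_gt0 : 0 < pi / 2 :> R.
Proof. by rewrite divr_gt0 ?pi_gt0. Qed.

Lemma continuous_cos_moment tau n :
  continuous (fun x => cosh (2 * tau * x) * cos x ^+ n.*2).
Proof. by cont. Qed.

Lemma cos_moment0 tau : 0 < tau -> cos_moment tau 0 = sinh (pi * tau) / (2 * tau).
Proof.
move=> t0.
pose F x := sinh (2 * tau * x) / (2 * tau).
have dF x : is_derive x 1 F (cosh (2 * tau * x) * cos x ^+ 0.*2).
  by rewrite /F; isder; rewrite /= expr0; field; lra.
rewrite /cos_moment (integral_segment_derivative F _ _ _ pihalf_gt0 dF).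
  by rewrite /F mulr0 sinh0 mul0r subr0; congr (sinh _ / _); field.
exact: continuous_cos_moment.
Qed.

(** Two integrations by parts, whose boundary terms vanish: the factors sin x and
sinh (2 tau x) vanish at 0 and cos x vanishes at pi / 2. *)
Lemma cos_moment_rec tau n :
  (n.+1%:R ^+ 2 + tau ^+ 2) * cos_moment tau n.+1 =
  n.+1%:R * (n.+1%:R - 2^-1) * cos_moment tau n.
Proof.
have i m := integrable_segment _ 0 (pi / 2) (continuous_cos_moment tau m).
have i' m c := integrable_scale _ c _ (measurable_itv _) (i m).
apply/eqP; rewrite -subr_eq0 -!RintegralZl//.
rewrite -RintegralB//; apply/eqP.
pose F x := - 4^-1 *
  (cosh (2 * tau * x) * (- (2 * n.+1%:R) * (sin x * cos x ^+ n.*2.+1)) -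
   2 * tau * (sinh (2 * tau * x) * cos x ^+ n.*2.+2)).
pose f x := (n.+1%:R ^+ 2 + tau ^+ 2) * (cosh (2 * tau * x) * cos x ^+ n.+1.*2) -
  n.+1%:R * (n.+1%:R - 2^-1) * (cosh (2 * tau * x) * cos x ^+ n.*2).
have dF x : is_derive x 1 F (f x).
  rewrite /F /f; isder; rewrite /= doubleS.
  set C := cos x; set D := cosh _; set E := sinh _.
  have sC : sin x * sin x = 1 - C * C by rewrite -!expr2 /C sin2cos2.
  have k2 : n.*2.+2%:R = 2 * n.+1%:R :> R by rewrite -natrM mul2n doubleS.
  have k1 : n.*2.+1%:R = 2 * n.+1%:R - 1 :> R.
    by rewrite -k2 -[n.*2.+2%:R]natr1 addrK.
  transitivity (- 4^-1 * (D * - (2 * n.+1%:R) *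
      (C ^+ n.*2.+2 - n.*2.+1%:R * (sin x * sin x) * C ^+ n.*2)
      - (2 * tau) ^+ 2 * D * C ^+ n.*2.+2)).
    by rewrite k2 !exprS; ring.
  by rewrite sC k1 !exprS; field.
rewrite (integral_segment_derivative F f _ _ pihalf_gt0)//.
- rewrite /F cos_pihalf sin0 !mulr0 sinh0 -[n.*2.+2]addn1 !exprS.
  by rewrite !mul0r !mulr0; ring.
- by rewrite /f; cont.
Qed.

End cosine_moments.

(** * The Fourier transform of sech squared *)

Section sech_transform.
Context {R : realType}.
Notation mu := (@lebesgue_measure R).
Implicit Types tau x s : R.

(** The weight sech2 ^ N concentrates at 0: 1 - cos (tau s) is at most
tau ^ 2 s ^ 2 <= 16 tau ^ 2 sinh (s / 2) ^ 2, and sinh (s / 2) ^ 2 sech2 ^ (N + 1)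
is sech2 ^ N - sech2 ^ (N + 1), whose integral the recurrence at tau = 0 gives. *)
Lemma sech_moment_near tau n :
  `|sech_moment tau n.+2 - sech_moment 0 n.+2| <=
  8 * tau ^+ 2 / n.+1%:R * sech_moment (0 : R) n.+2.
Proof.
have i0 k := integrable_sech_moment (0 : R) k.
have it k := integrable_sech_moment tau k.
have i1 := integrable_sub _ _ _ measurableT (i0 n) (i0 n.+1).
have i2 := integrable_scale _ (16 * tau ^+ 2) _ measurableT i1.
have i3 := integrable_sub _ _ _ measurableT (it n.+1) (i0 n.+1).
rewrite -RintegralB//.
apply: le_trans (le_normr_Rintegral measurableT i3) _.
apply: le_trans (le_Rintegral measurableT (integrable_norm i3) i2 _) _.
  move=> s _ /=; rewrite !mul0r cos0 !mul1r.
  have q0 : 0 <= sech2 s ^+ n.+2 by rewrite exprn_ge0 ?sech2_ge0.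
  have e : sech2 s ^+ n.+1 = cosh (s / 2) ^+ 2 * sech2 s ^+ n.+2.
    by rewrite [in RHS]exprS mulrA mulfV ?mul1r// cosh_half_sqr_neq0.
  have -> : cos (tau * s) * sech2 s ^+ n.+2 - sech2 s ^+ n.+2 =
      - ((1 - cos (tau * s)) * sech2 s ^+ n.+2) by ring.
  have -> : 16 * tau ^+ 2 * (sech2 s ^+ n.+1 - sech2 s ^+ n.+2) =
      16 * tau ^+ 2 * sinh (s / 2) ^+ 2 * sech2 s ^+ n.+2.
    by rewrite e cosh2_sinh2; ring.
  rewrite normrN normrM (ger0_norm q0) ler_wpM2r//.
  rewrite ger0_norm ?subr_ge0 ?cos_le1//.
  apply: le_trans (one_sub_cos_le _) _.
  rewrite exprMn.
  rewrite (_ : 16 * _ * _ = tau ^+ 2 * (16 * sinh (s / 2) ^+ 2)); last by ring.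
  rewrite ler_wpM2l ?sqr_ge0//.
  by have := sqr_le_sinh2 (s / 2); rewrite expr_div_n; lra.
rewrite RintegralZl// RintegralB//.
have := sech_moment_rec (0 : R) n; rewrite -/(sech_moment _ _) -/(sech_moment _ _).
set a := sech_moment 0 n.+1; set b := sech_moment 0 n.+2 => rec.
have n0 : n.+1%:R != 0 :> R by [].
have -> : a = (n.+1%:R + 2^-1) / n.+1%:R * b.
  apply: (mulfI (_ : n.+1%:R ^+ 2 != 0)); first by rewrite expf_neq0.
  by rewrite expr0n addr0 in rec; rewrite rec; field.
by rewrite le_eqVlt; apply/orP; left; apply/eqP; field.
Qed.

Lemma sech_moment0_ge0 n : 0 <= sech_moment (0 : R) n.
Proof.
apply: Rintegral_ge0 => s _; rewrite mul0r cos0 mul1r.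
by rewrite exprn_ge0// sech2_ge0.
Qed.

Lemma cos_moment0_ge0 n : 0 <= cos_moment (0 : R) n.
Proof.
apply: Rintegral_ge0 => x _; rewrite mulr0 mul0r cosh0 mul1r.
by rewrite exprn_even_ge0// odd_double.
Qed.

(** The weight cos x ^ (2 N) concentrates at 0: cosh (2 tau x) - 1 is at most a
multiple of x ^ 2, and x ^ 2 cos x ^ 2 <= sin x ^ 2 turns the error into a
difference of consecutive moments at tau = 0. *)
Lemma cos_moment_near tau n : 0 <= tau ->
  `|cos_moment tau n.+1 - cos_moment 0 n.+1| <=
  4 * tau ^+ 2 * expR (pi * tau) / n.+1%:R * cos_moment (0 : R) n.+1.
Proof.
move=> t0; set K := 4 * tau ^+ 2 * expR (pi * tau).
have K0 : 0 <= K by rewrite !mulr_ge0 ?expR_ge0// sqr_ge0.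
have i (a : R) k := integrable_segment _ 0 (pi / 2) (continuous_cos_moment a k).
have mI : measurable
    (`[0, pi / 2]%classic : set (g_sigma_algebraType (R.-ocitv.-measurable))).
  exact: measurable_itv.
have i1 := integrable_sub _ _ _ mI (i 0 n) (i 0 n.+1).
have i2 := integrable_scale _ K _ mI i1.
have i3 := integrable_sub _ _ _ mI (i tau n.+1) (i 0 n.+1).
rewrite -RintegralB//.
apply: le_trans (le_normr_Rintegral mI i3) _.
apply: le_trans (le_Rintegral mI (integrable_norm i3) i2 _) _.
  move=> x /=; rewrite in_itv/= => /andP[x0 x1].
  rewrite mulr0 mul0r cosh0 !mul1r doubleS.
  have p0 : 0 <= cos x ^+ n.*2 by rewrite exprn_even_ge0// odd_double.
  have tx0 : 0 <= 2 * tau * x by rewrite !mulr_ge0.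
  have c0 : 0 <= cos x by rewrite cos_ge0_pihalf// x1 andbT; lra.
  have s1 : x * cos x <= sin x by rewrite mul_cos_le_sin// x0.
  have s2 : (x * cos x) ^+ 2 <= sin x ^+ 2.
    by rewrite ler_sqr ?nnegrE// ?(le_trans _ s1)// mulr_ge0.
  have -> : cosh (2 * tau * x) * cos x ^+ n.*2.+2 - cos x ^+ n.*2.+2 =
      (cosh (2 * tau * x) - 1) * cos x ^+ 2 * cos x ^+ n.*2.
    by rewrite !exprS; ring.
  have -> : K * (cos x ^+ n.*2 - cos x ^+ n.*2.+2) =
      K * sin x ^+ 2 * cos x ^+ n.*2.
    by rewrite sin2cos2 !exprS; ring.
  have ch : 0 <= cosh (2 * tau * x) - 1 by rewrite subr_ge0 cosh_ge1.
  rewrite ger0_norm; last by rewrite !mulr_ge0// sqr_ge0.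
  rewrite ler_wpM2r//.
  apply: (@le_trans _ _ (K * x ^+ 2 * cos x ^+ 2)).
    rewrite ler_wpM2r ?sqr_ge0//.
    apply: le_trans (cosh_sub_one_le _ tx0) _.
    have -> : (2 * tau * x) ^+ 2 = 4 * tau ^+ 2 * x ^+ 2 by ring.
    rewrite /K [leRHS]mulrAC ler_wpM2l ?mulr_ge0 ?sqr_ge0//.
    by rewrite ler_expR; nra.
  by rewrite -mulrA ler_wpM2l// -exprMn.
rewrite RintegralZl// RintegralB//.
have := cos_moment_rec (0 : R) n; rewrite -/(cos_moment _ _) -/(cos_moment _ _).
have := cos_moment0_ge0 n.+1.
set a := cos_moment 0 n.+1; set b := cos_moment 0 n => a0 rec.
have n0 : n.+1%:R != 0 :> R by [].
have n1 : 1 <= n.+1%:R :> R by rewrite ler1n.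
have n2 : n.+1%:R - 2^-1 != 0 :> R by rewrite gt_eqF//; lra.
have -> : b = n.+1%:R / (n.+1%:R - 2^-1) * a.
  rewrite expr0n addr0 in rec.
  apply: (mulfI (_ : n.+1%:R * (n.+1%:R - 2^-1) != 0)); first by rewrite mulf_neq0.
  by rewrite -rec; field.
rewrite -[leRHS]mulrA ler_wpM2l//.
have -> : n.+1%:R / (n.+1%:R - 2^-1) * a - a = 2^-1 / (n.+1%:R - 2^-1) * a.
  by field.
rewrite ler_wpM2r// ler_pdivrMr; last by lra.
rewrite mulrBr mulVf//.
have h : n.+1%:R^-1 <= 1 :> R by rewrite invf_le1.
by move: (n.+1%:R^-1) h => v h; lra.
Qed.

(** By the two recurrences, (n + 1 / 2) times the product of the moments of
sech2 ^ (n + 1) and of cos ^ (2 n) does not depend on n.  At tau = 0 its value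
is pi, and for large n the moments at tau and at 0 differ by a relative error
of order 1 / n, so its value is pi for every tau. *)
Lemma sech2_transform tau : 0 < tau ->
  \int[mu]_s (cos (tau * s) * sech2 s) = 4 * pi * tau / sinh (pi * tau).
Proof.
move=> t0.
have t0' := ltW t0.
have sh0 : 0 < sinh (pi * tau) by rewrite sinh_gt0// mulr_gt0// pi_gt0.
(* The two recurrences share the factor n ^+ 2 + a ^+ 2, one on each side, so
   it cancels in the product of the moments. *)
have prodE (a : R) n :
    (n%:R + 2^-1) * (sech_moment a n.+1 * cos_moment a n) =
    2^-1 * (sech_moment a 1 * cos_moment a 0).
  elim: n => [|n <-]; first by rewrite add0r.
  have h : n.+1%:R ^+ 2 + a ^+ 2 != 0.
    by rewrite gt_eqF// ltr_pwDl ?sqr_ge0// exprn_gt0.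
  have n0 : n.+1%:R != 0 :> R by [].
  apply: (mulfI h); apply: (mulfI n0).
  transitivity ((n.+1%:R * (n.+1%:R + 2^-1) * sech_moment a n.+2) *
      ((n.+1%:R ^+ 2 + a ^+ 2) * cos_moment a n.+1)); first by ring.
  rewrite -sech_moment_rec cos_moment_rec.
  rewrite (_ : n.+1%:R - 2^-1 = n%:R + 2^-1 :> R); first by ring.
  by rewrite -natr1; field.
have S10 : sech_moment (0 : R) 1 = 4.
  rewrite -integral_sech2; apply: eq_Rintegral => s _.
  by rewrite mul0r cos0 mul1r expr1.
have C00 : cos_moment (0 : R) 0 = pi / 2.
  rewrite /cos_moment -[RHS]mul1r.
  transitivity (\int[mu]_(x in `[0, pi / 2]) (1 : R)).
    by apply: eq_Rintegral => x _; rewrite mulr0 mul0r cosh0 mulr1.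
  rewrite Rintegral_cst//= lebesgue_measure_itv//= lte_fin pihalf_gt0.
  by rewrite oppr0 addr0.
pose A := 8 * tau ^+ 2; pose K := 4 * tau ^+ 2 * expR (pi * tau).
have A0 : 0 <= A by rewrite mulr_ge0 ?sqr_ge0.
have K0 : 0 <= K by rewrite !mulr_ge0 ?expR_ge0// sqr_ge0.
have main n : `|2^-1 * (sech_moment tau 1 * cos_moment tau 0) - pi| <=
    pi * (A * (1 + K) + K) / n.+1%:R.
  have -> : pi = 2^-1 * (sech_moment (0 : R) 1 * cos_moment 0 0).
    by rewrite S10 C00; field.
  rewrite -!(prodE _ n.+1).
  have := sech_moment_near tau n; have := cos_moment_near tau n t0'.
  rewrite -/A -/K.
  have := sech_moment0_ge0 n.+2; have := cos_moment0_ge0 n.+1.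
  set S := sech_moment tau n.+2; set S0 := sech_moment 0 n.+2.
  set C := cos_moment tau n.+1; set C0 := cos_moment 0 n.+1 => C0p S0p hC hS.
  clearbody A K S S0 C C0.
  have n1 : 1 <= n.+1%:R :> R by rewrite ler1n.
  have n0 : 0 < n.+1%:R :> R by [].
  rewrite -mulrBr normrM ger0_norm; last by rewrite addr_ge0.
  rewrite -!mulrA ler_wpM2l ?addr_ge0//.
  have -> : S * C - S0 * C0 = (S - S0) * C0 + (S - S0) * (C - C0) + S0 * (C - C0).
    by ring.
  have hC1 : `|C - C0| <= K * C0.
    by rewrite (le_trans hC)// ler_wpM2r// ler_pdivrMr// ler_peMr.
  have [] := (normr_ge0 (S - S0), normr_ge0 (C - C0)) => a0 b0.
  apply: le_trans (ler_normD _ _) _.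
  apply: le_trans (lerD (ler_normD _ _) (lexx _)) _.
  rewrite !normrM (ger0_norm C0p) (ger0_norm S0p).
  have -> : S0 * (C0 * ((A * (1 + K) + K) / n.+1%:R)) =
     A / n.+1%:R * S0 * C0 + A / n.+1%:R * S0 * (K * C0) + S0 * (K / n.+1%:R * C0).
    by field.
  by rewrite !lerD// ?ler_wpM2r// ?ler_wpM2l// ler_pM.
have /eqP : 2^-1 * (sech_moment tau 1 * cos_moment tau 0) - pi = 0.
  apply/eqP; rewrite -normr_le0; apply/ler_addgt0Pr => e e0.
  set D := pi * _ in main; rewrite add0r.
  (* The bound D / N.+1 is at most e as soon as N.+1 >= D / e. *)
  pose N := Num.truncn (D / e).
  apply: le_trans (main N) _; rewrite ler_pdivrMr// mulrC -ler_pdivrMr//.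
  by apply/ltW/truncnS_gt.
rewrite subr_eq0 => /eqP; rewrite cos_moment0// => h.
transitivity (sech_moment tau 1).
  by apply: eq_Rintegral => s _; rewrite expr1.
move: h sh0; set sh := sinh _; clearbody sh => h sh0.
by rewrite -h; field; rewrite !gt_eqF.
Qed.

End sech_transform.

(** * The Fourier transform of 1 / (cosh u + cosh y) *)

Section cosine_transform_of_sum.
Context {R : realType}.
Notation mu := (@lebesgue_measure R).
Implicit Types tau u y a : R.

Lemma cosh_le_expR y : cosh y <= expR `|y|.
Proof.
have h z : 0 <= z -> cosh z <= expR z.
  move=> z0; rewrite /cosh ler_pdivrMr// mulr_natr mulr2n lerD2l ler_expR.
  by rewrite (le_trans _ z0)// oppr_le0.
by have [y0|y0] := ger0P y; [exact: h|rewrite -coshN h// oppr_ge0 ltW].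
Qed.

Lemma cosh_le_shift u y : cosh u <= 2 * cosh y * cosh (u + y).
Proof.
rewrite {1}(_ : u = (u + y) + - y); last by rewrite addrK.
rewrite coshD coshN sinhN; have := norm_sinh_le (u + y).
have := norm_sinh_le y; rewrite !ler_norml => /andP[a1 a2] /andP[b1 b2].
by have := cosh_gt0 y; have := cosh_gt0 (u + y); nra.
Qed.

Lemma sech2_shift_le u y c : `|y| <= c -> sech2 (u + y) <= 4 * expR c * (cosh u)^-1.
Proof.
move=> yc; apply: le_trans (sech2_le _) _.
rewrite ler_pdivlMr ?cosh_gt0// mulrAC ler_pdivrMr ?cosh_gt0//.
apply: (@le_trans _ _ (2 * (2 * cosh y * cosh (u + y)))).
  by rewrite ler_wpM2l// cosh_le_shift.
have h : cosh y <= expR c by rewrite (le_trans (cosh_le_expR y))// ler_expR.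
rewrite (_ : 2 * (2 * _ * _) = 4 * cosh y * cosh (u + y)); last by ring.
by rewrite ler_wpM2r ?cosh_ge0// ler_wpM2l.
Qed.

(** The difference of two values of tanh in terms of the angle between them,
2 cosh A cosh B being cosh (A + B) + cosh (A - B). *)
Lemma tanh_half_sub u y :
  (tanh_half (u + y) - tanh_half (u - y)) / 2 = sinh y / (cosh u + cosh y).
Proof.
rewrite /tanh_half; set A := (u + y) / 2; set B := (u - y) / 2.
have -> : sinh y = sinh (A - B) by congr sinh; rewrite /A /B; field.
have -> : cosh u = cosh (A + B) by congr cosh; rewrite /A /B; field.
have -> : cosh y = cosh (A - B) by congr cosh; rewrite /A /B; field.
rewrite sinhD !coshD coshN sinhN; have := cosh_neq0 A; have := cosh_neq0 B => b0 a0.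
have c0 : cosh A * cosh B != 0 by rewrite mulf_neq0.
rewrite (_ : cosh A * cosh B + sinh A * sinh B +
  (cosh A * cosh B + sinh A * - sinh B) = 2 * (cosh A * cosh B)); last by ring.
by field; rewrite b0.
Qed.

Lemma cosh_sum_gt0 u y : 0 < cosh u + cosh y.
Proof. by rewrite addr_gt0// cosh_gt0. Qed.

Lemma cosh_sum_neq0 u y : cosh u + cosh y != 0.
Proof. by rewrite gt_eqF// cosh_sum_gt0. Qed.

Lemma continuous_cos_over_cosh_sum tau y :
  continuous (fun u => cos (tau * u) * (cosh u + cosh y)^-1).
Proof. by cont => x; exact: cosh_sum_neq0. Qed.

Lemma integrable_cos_over_cosh_sum tau y :
  mu.-integrable setT (EFin \o (fun u => cos (tau * u) * (cosh u + cosh y)^-1)).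
Proof.
apply: continuous_integrable_le integrable_sech _.
  exact: continuous_cos_over_cosh_sum.
move=> u; have h0 : 0 <= (cosh u + cosh y)^-1.
  by rewrite invr_ge0 ltW ?cosh_sum_gt0.
rewrite mulrC (le_trans (norm_cos_le1 _ _ h0))//.
by rewrite lef_pV2 ?posrE ?cosh_gt0 ?cosh_sum_gt0// lerDl cosh_ge0.
Qed.

(** Translating each term moves the shifts into the cosines, and
cos (tau (s - y)) + cos (tau (s + y)) = 2 cos (tau s) cos (tau y). *)
Lemma integral_cos_sech2_shift tau y :
  \int[mu]_u (cos (tau * u) * (sech2 (u + y) + sech2 (u - y))) =
  2 * cos (tau * y) * \int[mu]_s (cos (tau * s) * sech2 s).
Proof.
pose f z s := cos (tau * (s - z)) * sech2 s.
have cf z : continuous (f z) by rewrite /f; cont; exact: continuous_sech2.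
have bf z s : `|f z s| <= sech2 s.
  by rewrite /f mulrC norm_cos_le1// sech2_ge0.
have fi z : mu.-integrable setT (EFin \o f z).
  exact: continuous_integrable_le (cf z) integrable_sech2 (bf z).
have si z := integrable_shift _ z (cf z) (fi z).
transitivity (\int[mu]_u (f y (u + y) + f (- y) (u + - y))).
  by apply: eq_Rintegral => u _; rewrite /f opprK addrK subrK mulrDr.
rewrite RintegralD// !Rintegral_shift// -RintegralD//.
rewrite -RintegralZl//; last first.
  by have := fi 0; rewrite /f; under eq_fun do rewrite subr0.
apply: eq_Rintegral => s _; rewrite /f opprK mulrBr mulrDr cosB cosD; ring.
Qed.

(** The derivative in y of the transform of sinh y / (cosh u + cosh y) is the
transform of two translates of sech2, that is cos (tau y) times a constant, and
the transform vanishes at y = 0. *)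
Lemma cos_over_cosh_sum tau y : 0 < tau -> 0 < y ->
  \int[mu]_(u in `]0, +oo[) (cos (tau * u) * (cosh u + cosh y)^-1) =
  pi * sin (tau * y) / (sinh y * sinh (pi * tau)).
Proof.
move=> t0 y0.
have t0' : tau != 0 by rewrite gt_eqF.
have sy0 : sinh y != 0 by rewrite gt_eqF// sinh_gt0.
have st0 : sinh (pi * tau) != 0 by rewrite gt_eqF// sinh_gt0// mulr_gt0// pi_gt0.
pose k z u := cos (tau * u) * ((tanh_half (u + z) - tanh_half (u - z)) / 2).
pose dk z u := 4^-1 * (cos (tau * u) * (sech2 (u + z) + sech2 (u - z))).
have kE z u : k z u = sinh z * (cos (tau * u) * (cosh u + cosh z)^-1).
  by rewrite /k tanh_half_sub; ring.
have ki z : mu.-integrable setT (EFin \o k z).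
  have := integrable_scale _ (sinh z) _ measurableT
    (integrable_cos_over_cosh_sum tau z).
  by apply: eq_integrable => // u _ /=; rewrite kE.
pose S := \int[mu]_s (cos (tau * s) * sech2 s).
have cdk z : continuous (fun u => cos (tau * u) * (sech2 (u + z) + sech2 (u - z))).
  have cs c : continuous (fun u => sech2 (u + c)).
    by apply: (cont_comp sech2); [exact: continuous_sech2|cont].
  by cont; exact: cs.
have sle (u z c : R) : `|z| <= c ->
    `|cos (tau * u) * (sech2 (u + z) + sech2 (u - z))| <=
    8 * expR c * (cosh u)^-1.
  move=> zc; rewrite mulrC (le_trans (norm_cos_le1 _ _ _))//.
    by rewrite addr_ge0// sech2_ge0.
  have h1 := sech2_shift_le u _ _ zc; have : `|- z| <= c by rewrite normrN.
  by move/(sech2_shift_le u) => h2; lra.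
have dki z : mu.-integrable setT
    (EFin \o (fun u => cos (tau * u) * (sech2 (u + z) + sech2 (u - z)))).
  apply: (continuous_integrable_le _ _ (cdk z)
    (integrable_scale _ (8 * expR `|z|) _ measurableT integrable_sech)) => u.
  exact: sle.
pose J z := \int[mu]_u k z u.
have dJ z : is_derive z (1 : R) J (2^-1 * cos (tau * z) * S).
  have <- : \int[mu]_u dk z u = 2^-1 * cos (tau * z) * S.
    by rewrite RintegralZl// integral_cos_sech2_shift -/S; field.
  apply: (is_derive_under_integral k dk
    (fun u => 4^-1 * (8 * expR (`|z| + 1) * (cosh u)^-1))).
  - exact: ki.
  - move=> a u; rewrite /k /dk.
    have d1 : is_derive a (1 : R) (fun z => u + z) 1.
      by isder; rewrite add0r.
    have d2 : is_derive a (1 : R) (fun z => u - z) (- 1).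
      by isder; rewrite add0r.
    have T1 := derive_comp tanh_half (fun z => u + z) a _ _
      (is_derive_tanh_half (u + a)) d1.
    have T2 := derive_comp tanh_half (fun z => u - z) a _ _
      (is_derive_tanh_half (u - a)) d2.
    isder; [exact: T1|exact: T2|].
    by rewrite /=; field.
  - exact: integrable_scale (integrable_scale _ _ _ measurableT integrable_sech).
  - move=> a u az; rewrite /dk normrM ger0_norm// ler_wpM2l//.
    apply: sle; have : `|a - z| <= 1 by rewrite ler_distl !ltW//; lra.
    by move=> h; rewrite -[a](subrK z) addrC (le_trans (ler_normD _ _))// lerD2l.
have dH z : is_derive z (1 : R) (fun z => J z - S / (2 * tau) * sin (tau * z)) 0.
  by isder; [exact: dJ|rewrite /=; field].
have := is_derive_0_is_cst y 0 dH.
rewrite mulr0 sin0 mulr0 subr0.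
have -> : J 0 = 0.
  transitivity (\int[mu]_(u in [set: R]) (0 : R)).
    by apply: eq_Rintegral => u _; rewrite kE sinh0 mul0r.
  by rewrite Rintegral_cst// mul0r.
move/eqP; rewrite subr_eq0 => /eqP.
have -> : J y = sinh y * \int[mu]_u (cos (tau * u) * (cosh u + cosh y)^-1).
  rewrite -RintegralZl//; last exact: integrable_cos_over_cosh_sum.
  by apply: eq_Rintegral => u _; rewrite kE.
rewrite Rintegral_even; first last.
- by move=> u; rewrite mulrN cosN coshN.
- exact: integrable_cos_over_cosh_sum.
- exact: continuous_cos_over_cosh_sum.
rewrite /S sech2_transform//; set I := Rintegral _ _ _ => h.
rewrite (_ : I / 2 = sinh y * I / (2 * sinh y)); last by field.
by rewrite h; field; rewrite sy0 st0 t0'.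
Qed.

End cosine_transform_of_sum.

(** * The spectral representation of the Yor integral *)

Section macdonald.
Context {R : realType}.
Notation mu := (@lebesgue_measure R).
Implicit Types tau r t u : R.

Lemma expRN_le (x : R) : 0 < x -> expR (- x) <= 2 / x ^+ 2.
Proof.
move=> x0; rewrite ler_pdivlMr ?exprn_gt0// expRN mulrC ler_pdivrMr ?expR_gt0//.
have := @expR_ge1Dxn R x 1 (ltW x0); rewrite (_ : 2`!%N = 2%N)//; lra.
Qed.

(** The double exponential decay is used only through exp (- x) <= 2 / x ^ 2, which
already leaves an integrable sech. *)
Lemma expRN_cosh_le r u : 0 < r ->
  r * cosh u * expR (- (r * cosh u)) <= 2 / r * (cosh u)^-1.
Proof.
move=> r0; have c0 := cosh_gt0 u; have rc : 0 < r * cosh u by rewrite mulr_gt0.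
have -> : 2 / r * (cosh u)^-1 = r * cosh u * (2 / (r * cosh u) ^+ 2).
  by field; rewrite !gt_eqF.
by rewrite ler_wpM2l ?expRN_le// ltW.
Qed.

Lemma integrable_expRN_cosh r : 0 < r ->
  mu.-integrable setT (EFin \o (fun u => r * cosh u * expR (- (r * cosh u)))).
Proof.
move=> r0; apply: (continuous_integrable_le _ _ _
  (integrable_scale _ (2 / r) _ measurableT integrable_sech)); first by cont.
move=> u; rewrite ger0_norm ?expRN_cosh_le// !mulr_ge0 ?expR_ge0 ?cosh_ge0//.
exact: ltW.
Qed.

Lemma integrable_macdonald_integrand tau r : 0 < r ->
  mu.-integrable setT (EFin \o (fun u => expR (- (r * cosh u)) * cos (tau * u))).
Proof.
move=> r0; apply: (continuous_integrable_le _ _ _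
  (integrable_scale _ r^-1 _ measurableT (integrable_expRN_cosh r r0))).
  by cont.
move=> u; rewrite (le_trans (norm_cos_le1 _ _ _)) ?expR_ge0//.
by rewrite !mulrA mulVf ?gt_eqF// mul1r ler_peMl ?expR_ge0// cosh_ge1.
Qed.

(** The integrand of tau * K_{i tau}(r) after integration by parts. *)
Definition macdonald_sin_integrand r tau u :=
  r * sinh u * expR (- (r * cosh u)) * sin (tau * u).

Lemma macdonald_parts_le r tau u : 0 < r ->
  `|macdonald_sin_integrand r tau u| <= r * cosh u * expR (- (r * cosh u)).
Proof.
move=> r0; rewrite /macdonald_sin_integrand normrM.
apply: le_trans (ler_piMr _ (sin_max _)) _ => //.
rewrite normrM (ger0_norm (expR_ge0 _)) ler_wpM2r ?expR_ge0// normrM gtr0_norm//.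
by rewrite ler_pM2l// norm_sinh_le.
Qed.

Lemma macdonald_by_parts r tau : 0 < r ->
  tau * macdonald_im tau r = \int[mu]_(u in `]0, +oo[) macdonald_sin_integrand r tau u.
Proof.
move=> r0.
have iK := integrable_macdonald_integrand tau r r0.
have iP : mu.-integrable setT (EFin \o macdonald_sin_integrand r tau).
  apply: continuous_integrable_le (integrable_expRN_cosh r r0) _.
    by rewrite /macdonald_sin_integrand; cont.
  by move=> u; exact: macdonald_parts_le.
have cK : continuous (fun u => expR (- (r * cosh u)) * cos (tau * u)) by cont.
have cP : continuous (macdonald_sin_integrand r tau) by rewrite /macdonald_sin_integrand; cont.
rewrite /macdonald_im (Rintegral_even _ cK iK); last first.
  by move=> u; rewrite coshN mulrN cosN.
rewrite (Rintegral_even _ cP iP); last first.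
  by move=> u; rewrite /macdonald_sin_integrand coshN mulrN sinN sinhN; ring.
rewrite mulrA; congr (_ / _); rewrite -RintegralZl//.
apply/eqP; rewrite -subr_eq0 -RintegralB//; last exact: integrable_scale.
apply/eqP; pose F u := expR (- (r * cosh u)) * sin (tau * u).
pose f u := tau * (expR (- (r * cosh u)) * cos (tau * u)) - macdonald_sin_integrand r tau u.
apply: (Rintegral_derivative_eq0 F f (r^-1 * 4)).
- move=> u; rewrite /F /f /macdonald_sin_integrand; isder; rewrite /=; ring.
- by rewrite /f /macdonald_sin_integrand; cont.
- by apply: integrable_sub => //; exact: integrable_scale.
- move=> u; apply: (@le_trans _ _ (expR (- (r * cosh u)) * u ^+ 2)).
    by rewrite ler_wpM2r ?sqr_ge0// norm_sin_le1 ?expR_ge0.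
  rewrite expRN mulrC ler_pdivrMr ?expR_gt0//.
  apply: le_trans (sqr_le_cosh u) _; rewrite [r^-1 * 4]mulrC -mulrA ler_wpM2l//.
  rewrite ler_pdivlMl//; apply: le_trans (expR_ge1Dx _).
  by rewrite lerDr.
Qed.

(** Interchange the integrals over tau and u in the product of the Gaussian weight
with the sine form of tau * K_{i tau}(r), and evaluate the integral over tau. *)
Lemma yor_integral_spectral r t : 0 < r -> 0 < t ->
  (yor_integral t r)%:E =
  ((1 / (r * pi ^+ 2))%:E *
   \int[mu]_(tau in `]0%R, +oo[)
     (expR (- (t / 2 * tau ^+ 2)) * tau * sinh (pi * tau) *
      macdonald_im tau r)%:E)%E.
Proof.
move=> r0 t0.
have p0 : 0 < pi :> R by exact: pi_gt0.
have mD : measurable (`]0, +oo[%classic : set R) by exact: measurable_itv.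
pose w tau := expR (- (t / 2 * tau ^+ 2)).
pose f tau u := w tau * sinh (pi * tau) * macdonald_sin_integrand r tau u.
pose D : set R := `]0, +oo[%classic.
have mf : measurable_fun setT (fun z : R * R => f z.1 z.2).
  by rewrite /f /w /macdonald_sin_integrand; meas.
have ia := integrable_itv _ (integrable_gauss_cosh t pi t0) `]0, +oo[.
have ib := integrable_itv _ (integrable_expRN_cosh r r0) `]0, +oo[.
have [|||fi fubini] := fubini_dominated D D f _ _ mD mD mf ia ib.
- by move=> x _; rewrite mulr_ge0 ?expR_ge0 ?cosh_ge0.
- by move=> x _; rewrite !mulr_ge0 ?expR_ge0 ?cosh_ge0// ltW.
- move=> tau u _ _; rewrite normrM ler_pM ?macdonald_parts_le//.
  by rewrite normrM ger0_norm ?expR_ge0// ler_wpM2l ?expR_ge0 ?norm_sinh_le.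
have ip tau : mu.-integrable D (EFin \o macdonald_sin_integrand r tau).
  apply: integrable_itv.
  apply: continuous_integrable_le (integrable_expRN_cosh r r0) _.
    by rewrite /macdonald_sin_integrand; cont.
  by move=> u; exact: macdonald_parts_le.
have innerE tau : \int[mu]_(u in D) f tau u =
    w tau * tau * sinh (pi * tau) * macdonald_im tau r.
  rewrite RintegralZl// -macdonald_by_parts//; ring.
under eq_integral do rewrite -/(w _) -innerE.
rewrite -Rintegral_EFin// -EFinM; congr EFin; rewrite fubini.
have k0 : Num.sqrt (2 * pi ^+ 3 * t) != 0.
  by rewrite gt_eqF// sqrtr_gt0 !mulr_gt0// exprn_gt0.
have kE : Num.sqrt (2 * pi / t) = 2 * pi ^+ 2 / Num.sqrt (2 * pi ^+ 3 * t).
  apply: (mulIf k0); rewrite divfK// -sqrtrM; last first.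
    by rewrite divr_ge0 ?mulr_ge0// ltW.
  rewrite (_ : 2 * pi / t * (2 * pi ^+ 3 * t) = (2 * pi ^+ 2) ^+ 2); last first.
    by field; rewrite gt_eqF.
  by rewrite sqrtr_sqr ger0_norm// mulr_ge0// sqr_ge0.
pose g y := expR (- (y ^+ 2 / (2 * t))) * expR (- (r * cosh y)) * sinh y *
  sin (pi * y / t).
(* The constant that the integral over tau leaves in front of g. *)
pose c := Num.sqrt (2 * pi / t) / 2 * expR (pi ^+ 2 / (2 * t)) * r.
transitivity ((1 / (r * pi ^+ 2)) * \int[mu]_(u in D) (c * g u)); last first.
  congr (_ * _); apply: eq_Rintegral => u _; apply: esym.
  transitivity (\int[mu]_(x in D) (r * sinh u * expR (- (r * cosh u)) *
      (expR (- (t / 2 * x ^+ 2)) * sinh (pi * x) * sin (u * x)))).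
    apply: eq_Rintegral => x _.
    by rewrite /f /w /macdonald_sin_integrand [u * x]mulrC; ring.
  rewrite RintegralZl//; last first.
    apply: integrable_itv.
    apply: continuous_integrable_le (integrable_gauss_cosh t pi t0) _.
      by cont.
    move=> x; apply: (@le_trans _ _ `|expR (- (t / 2 * x ^+ 2)) * sinh (pi * x)|).
      by rewrite normrM ler_piMr// sin_max.
    by rewrite normrM ger0_norm ?expR_ge0// ler_wpM2l ?expR_ge0 ?norm_sinh_le.
  by rewrite integral_gauss_sinh_sin// [(_ - _) / _]mulrBl expRD /c /g; ring.
have ig : mu.-integrable D (EFin \o g).
  apply: integrable_itv; apply: (continuous_integrable_le _ _ _
    (integrable_scale _ r^-1 _ measurableT (integrable_expRN_cosh r r0))).
    by rewrite /g; cont.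
  move=> y; have -> : r^-1 * (r * cosh y * expR (- (r * cosh y))) =
      cosh y * expR (- (r * cosh y)) by field; rewrite gt_eqF.
  apply: (@le_trans _ _
    `|expR (- (y ^+ 2 / (2 * t))) * expR (- (r * cosh y)) * sinh y|).
    by rewrite /g normrM ler_piMr// sin_max.
  rewrite normrM ger0_norm ?mulr_ge0 ?expR_ge0// mulrC ler_pM ?mulr_ge0 ?expR_ge0//.
    exact: norm_sinh_le.
  rewrite ler_piMl ?expR_ge0// expR_le1 oppr_le0 divr_ge0 ?sqr_ge0//.
  by rewrite mulr_ge0// ltW.
have -> : yor_integral t r = expR (pi ^+ 2 / (2 * t)) /
  Num.sqrt (2 * pi ^+ 3 * t) * \int[mu]_(u in D) g u by [].
rewrite RintegralZl// /c kE; move: (\int[mu]_(u in D) g u) => I.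
move: k0 p0; move: (Num.sqrt _) => k; move: (expR _) => E; move: pi => p k0 p0.
by field; rewrite k0 !gt_eqF.
Qed.

End macdonald.

(** * The reciprocal formula *)

Section inversion.
Context {R : realType}.
Notation mu := (@lebesgue_measure R).
Notation D := (`]0, +oo[%classic : set R).
Implicit Types tau r t u y k : R.

Lemma laplace_transform_one k : 0 < k ->
  mu.-integrable D (EFin \o (fun r => expR (- (r * k)))) /\
  \int[mu]_(r in D) expR (- (r * k)) = k^-1.
Proof.
move=> k0; have ck : continuous (fun r => expR (- (r * k))) by cont.
have mk : measurable_fun setT (fun r => expR (- (r * k))).
  exact: continuous_measurable_fun.
have E : (\int[mu]_(r in D) (expR (- (r * k)))%:E = (k^-1)%:E)%E.
  rewrite integral_itv_obnd_cbnd; last first.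
    by apply/measurable_EFinP; exact: measurable_funTS.
  pose F r := - (k^-1 * expR (- (r * k))).
  have dF r : is_derive r (1 : R) F (expR (- (r * k))).
    by rewrite /F; isder; rewrite /=; field; rewrite gt_eqF.
  have cF := is_derive_continuous F _ dF.
  rewrite (@ge0_continuous_FTC2y _ _ F 0 0).
  - by rewrite /F mul0r oppr0 expR0 mulr1 EFinN oppeK add0e.
  - by move=> x _; exact: expR_ge0.
  - exact: continuous_subspaceT.
  - rewrite -oppr0 -[X in - X](mulr0 k^-1); apply: cvgN; apply: cvgMr.
    apply: (cvg_comp (fun r => r * k) (fun r => expR (- r))); last exact: cvgr_expR.
    by apply: gt0_cvgMly => //; exact: cvg_id.
  - by move=> x _; case: (dF x).
  - by apply: cvg_at_right_filter; exact: cF.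
  - by move=> x _; rewrite derive1E; case: (dF x).
split; last by rewrite /Rintegral E.
apply/integrableP; split; first by apply/measurable_EFinP; exact: measurable_funTS.
under eq_integral do rewrite /= ger0_norm ?expR_ge0//.
by rewrite E ltry.
Qed.

(** Interchange the integrals over r and u; for fixed u the integral over r is that
of exp (- r (cosh u + cosh y)).  The absolute values are bounded by the same
integral without the cosine, which is finite although K_{i tau} may be unbounded
near 0. *)
Lemma laplace_macdonald tau y :
  mu.-integrable D
    (EFin \o (fun r => expR (- (r * cosh y)) * macdonald_im tau r)) /\
  \int[mu]_(r in D) (expR (- (r * cosh y)) * macdonald_im tau r) =
  \int[mu]_(u in D) (cos (tau * u) * (cosh u + cosh y)^-1).
Proof.
have mD : measurable D by exact: measurable_itv.
have cS : continuous (fun u => (cosh u + cosh y)^-1).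
  by cont => u; exact: cosh_sum_neq0.
have iS : mu.-integrable D (EFin \o (fun u => (cosh u + cosh y)^-1)).
  have := integrable_itv _ (integrable_cos_over_cosh_sum 0 y) `]0, +oo[.
  by apply: eq_integrable => // u _ /=; rewrite mul0r cos0 mul1r.
pose f r u := expR (- (r * (cosh u + cosh y))) * cos (tau * u).
have fE r u : f r u =
    expR (- (r * cosh y)) * (expR (- (r * cosh u)) * cos (tau * u)).
  by rewrite mulrA -expRD -opprD -mulrDr addrC.
have ab r u : `|f r u| <= expR (- (r * (cosh u + cosh y))).
  by rewrite norm_cos_le1 ?expR_ge0.
have L u := laplace_transform_one _ (cosh_sum_gt0 u y).
have iK r : D r ->
    mu.-integrable D (EFin \o (fun u => expR (- (r * cosh u)) * cos (tau * u))).
  rewrite /= in_itv/= andbT => r0.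
  exact/integrable_itv/integrable_macdonald_integrand.
have [||||] := fubini_on D D f mD mD.
- by rewrite /f; meas.
- rewrite (tonelli_on _ _ (fun r u => `|f r u|))//; last first.
    apply: (meas_comp Num.norm _ (@norm_continuous _ _)).
    by rewrite /f; meas.
  apply: (@le_lt_trans _ _ (\int[mu]_(u in D) ((cosh u + cosh y)^-1)%:E)%E).
    apply: ge0_le_integral => //.
    - by move=> u _; apply: integral_ge0 => r _; rewrite lee_fin.
    - apply: (measurable_integral_on _ _ (fun u r => `|f r u|)) => //.
      apply: (meas_comp Num.norm _ (@norm_continuous _ _)).
      by rewrite /f; meas.
    - by apply/measurable_EFinP/measurable_funTS; exact: continuous_measurable_fun.
    - move=> u _; rewrite -(L u).2 Rintegral_EFin//; last exact: (L u).1.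
      apply: ge0_le_integral => //.
      + apply/measurable_EFinP/measurable_funTS.
        apply: (meas_comp Num.norm _ (@norm_continuous _ _)).
        by rewrite /f; meas.
      + exact: (measurable_int mu (L u).1).
      + by move=> r _; rewrite lee_fin.
  by rewrite -Rintegral_EFin ?ltry.
- move=> r Dr; have := integrable_scale _ (expR (- (r * cosh y))) _ mD (iK r Dr).
  by apply: eq_integrable => // u _; rewrite /= fE.
- move=> u _; apply: measurable_integrable_le mD _ (L u).1 _ => //.
  by apply: measurable_funTS; rewrite /f; meas.
move=> fi fubini.
have innerE r : r \in D -> \int[mu]_(u in D) f r u =
    expR (- (r * cosh y)) * macdonald_im tau r.
  rewrite inE => Dr; rewrite /macdonald_im -RintegralZl//; last exact: iK.
  by apply: eq_Rintegral => u _; rewrite fE.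
split.
  by move: fi; apply: eq_integrable => // r Dr /=; rewrite innerE.
transitivity (\int[mu]_(r in D) \int[mu]_(u in D) f r u).
  by apply: eq_Rintegral => r Dr; rewrite innerE.
rewrite fubini; apply: eq_Rintegral => u _.
by rewrite RintegralZr ?(L u).2 1?mulrC//; case: (L u).
Qed.

Lemma macdonald_im_le tau r : 0 < r -> `|macdonald_im tau r| <= macdonald_im 0 r.
Proof.
move=> r0.
have i1 := integrable_itv _ (integrable_macdonald_integrand tau r r0) `]0, +oo[.
have i2 := integrable_itv _ (integrable_macdonald_integrand 0 r r0) `]0, +oo[.
have mD : measurable
    (`]0, +oo[%classic : set (g_sigma_algebraType (R.-ocitv.-measurable))).
  exact: measurable_itv.
apply: le_trans (le_normr_Rintegral mD i1) _.
apply: le_Rintegral => //; first exact: (integrable_norm i1).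
by move=> u _; rewrite mul0r cos0 mulr1 norm_cos_le1 ?expR_ge0.
Qed.

(** The product of sines is a difference of cosines, and the parameter of the
Gaussian is 1 / t. *)
Lemma integral_gauss_sin_sin t a b : 0 < t ->
  \int[mu]_(y in D) (expR (- (y ^+ 2 / (2 * t))) * sin (a * y) * sin (b * y)) =
  Num.sqrt (2 * pi * t) / 4 *
  (expR (- (t / 2 * (a - b) ^+ 2)) - expR (- (t / 2 * (a + b) ^+ 2))).
Proof.
move=> t0; have t0' : t != 0 by rewrite gt_eqF.
have ti0 : 0 < t^-1 by rewrite invr_gt0.
pose g c y := expR (- (t^-1 / 2 * y ^+ 2)) * cos (c * y).
have cg c : continuous (g c) by rewrite /g; cont.
have ig c : mu.-integrable setT (EFin \o g c).
  apply: continuous_integrable_le (cg c) (integrable_gauss _ ti0) _ => y.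
  by rewrite norm_cos_le1 ?expR_ge0.
have eg c y : g c (- y) = g c y by rewrite /g sqrrN mulrN cosN.
have igD c : mu.-integrable D (EFin \o g c) := integrable_itv _ (ig c) _.
transitivity (\int[mu]_(y in D) (2^-1 * (g (a - b) y - g (a + b) y))).
  apply: eq_Rintegral => y _; rewrite /g.
  have -> : (a - b) * y = a * y - b * y by ring.
  have -> : (a + b) * y = a * y + b * y by ring.
  rewrite cosB cosD.
  have -> : t^-1 / 2 * y ^+ 2 = y ^+ 2 / (2 * t) by field.
  by field.
have mD : measurable D by exact: measurable_itv.
rewrite RintegralZl//; last exact: integrable_sub.
rewrite RintegralB// !Rintegral_even// !integral_gauss_cos// invrK.
have cE c : c ^+ 2 / (2 * t^-1) = t / 2 * c ^+ 2 by field.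
rewrite !cE.
by field.
Qed.

(** The integral over (r, y) is dominated by the product of exp (- r) K_0(r) and
exp (- y ^ 2 / (2 t)) cosh y, so r can be integrated first; this yields the
transform of 1 / (cosh u + cosh y), whose denominator sinh y cancels the factor
sinh y of the Yor integral. *)
Lemma macdonald_yor_integral t tau : 0 < t -> 0 < tau ->
  (\int[mu]_(r in `]0%R, +oo[) (macdonald_im tau r * yor_integral t r)%:E =
  (expR (- (t / 2 * tau ^+ 2)) / 2)%:E)%E.
Proof.
move=> t0 tau0; have mD : measurable D by exact: measurable_itv.
have p0 : 0 < pi :> R by exact: pi_gt0.
have t0' : t != 0 by rewrite gt_eqF.
(* Outside D the Macdonald integral diverges; cutting it off there gives a function
   that is measurable on the whole line. *)
pose K := macdonald_im tau \_ D.
have KE r : r \in D -> K r = macdonald_im tau r by move=> Dr; rewrite /K patchE Dr.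
have mK : measurable_fun setT K.
  apply/(measurable_restrictT _ _).1 => //.
  have [iK _] := laplace_macdonald tau 0.
  have mE : measurable_fun D (fun r => expR (r * cosh 0)).
    by apply: measurable_funTS; meas.
  have mG : measurable_fun D
      (fun r => expR (- (r * cosh 0)) * macdonald_im tau r).
    by apply/measurable_EFinP; exact: (measurable_int mu iK).
  apply: eq_measurable_fun (measurable_funM mE mG) => r _ /=.
  by rewrite mulrA -expRD subrr expR0 mul1r.
pose a y := expR (- (y ^+ 2 / (2 * t))) * sinh y * sin (pi * y / t).
pose f r y := K r * (expR (- (r * cosh y)) * a y).
have mf : measurable_fun setT (fun z : R * R => f z.1 z.2).
  rewrite /f /a; apply: measurable_funM; last by meas.
  exact: measurableT_comp.
have [iM _] := laplace_macdonald 0 0.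
have ti0 : 0 < t^-1 by rewrite invr_gt0.
have ib := integrable_itv _ (integrable_gauss_cosh _ 1 ti0) `]0, +oo[.
have iN r : 0 < r -> 0 <= macdonald_im 0 r.
  by move=> r0; apply: le_trans (macdonald_im_le 0 _ r0).
have tE y : t^-1 / 2 * y ^+ 2 = y ^+ 2 / (2 * t) by field.
have [|||fi fubini] := fubini_dominated D D f _ _ mD mD mf iM ib.
- by move=> r; rewrite /= in_itv/= andbT => r0; rewrite mulr_ge0 ?expR_ge0 ?iN.
- by move=> y _; rewrite mulr_ge0 ?expR_ge0 ?cosh_ge0.
- move=> r y Dr Dy; rewrite /f KE ?inE//.
  have r0 : 0 < r by move: Dr; rewrite /= in_itv/= andbT.
  rewrite normrM [leRHS](_ : _ = macdonald_im 0 r * (expR (- (r * cosh 0)) *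
     (expR (- (y ^+ 2 / (2 * t))) * cosh y))); last by rewrite tE mul1r; ring.
  rewrite ler_pM ?macdonald_im_le// normrM ler_pM//.
    rewrite ger0_norm ?expR_ge0// ler_expR lerN2 ler_pM2l// cosh0.
    exact: cosh_ge1.
  rewrite /a normrM; apply: le_trans (ler_piMr _ (sin_max _)) _ => //.
  by rewrite normrM ger0_norm ?expR_ge0// ler_wpM2l ?expR_ge0 ?norm_sinh_le.
pose C := expR (pi ^+ 2 / (2 * t)) / Num.sqrt (2 * pi ^+ 3 * t).
have integrandE r : r \in D -> macdonald_im tau r * yor_integral t r =
    C * \int[mu]_(y in D) f r y.
  move=> Dr; rewrite /yor_integral -/C mulrCA; congr (C * _).
  have r0 : 0 < r by move: Dr; rewrite inE /= in_itv/= andbT.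
  rewrite -KE// -RintegralZl//.
    by apply: eq_Rintegral => y _; rewrite /f /a; ring.
  apply: integrable_itv.
  apply: (continuous_integrable_le _ _ _ (integrable_gauss_cosh _ 1 ti0)).
    by cont.
  move=> y; rewrite tE mul1r normrM.
  apply: le_trans (ler_piMr _ (sin_max _)) _ => //.
  rewrite normrM ger0_norm ?mulr_ge0 ?expR_ge0//.
  rewrite -mulrA ler_wpM2l ?expR_ge0//.
  apply: le_trans (norm_sinh_le y); rewrite ler_piMl//.
  by rewrite expR_le1 oppr_le0 mulr_ge0 ?cosh_ge0// ltW.
have sh0 : sinh (pi * tau) != 0 by rewrite gt_eqF// sinh_gt0// mulr_gt0.
pose g y := expR (- (y ^+ 2 / (2 * t))) * sin (pi / t * y) * sin (tau * y).
have ig : mu.-integrable D (EFin \o g).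
  apply: integrable_itv.
  apply: continuous_integrable_le (integrable_gauss _ ti0) _.
    by rewrite /g; cont.
  move=> y; rewrite tE /g -mulrA normrM ger0_norm ?expR_ge0//.
  by rewrite ler_piMr ?expR_ge0// normrM mulr_ile1 ?sin_max.
have innerE y : y \in D -> \int[mu]_(r in D) f r y = pi / sinh (pi * tau) * g y.
  move=> Dy; have y0 : 0 < y by move: Dy; rewrite inE /= in_itv/= andbT.
  have [iL LE] := laplace_macdonald tau y.
  transitivity (\int[mu]_(r in D)
      (a y * (expR (- (r * cosh y)) * macdonald_im tau r))).
    by apply: eq_Rintegral => r Dr; rewrite /f KE//; ring.
  rewrite RintegralZl// LE cos_over_cosh_sum// /a /g.
  rewrite (_ : pi * y / t = pi / t * y); last by ring.
  have sy0 : sinh y != 0 by rewrite gt_eqF// sinh_gt0.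
  by field; rewrite sy0 sh0.
rewrite (_ : integral _ _ _ =
  (\int[mu]_(r in D) (C * \int[mu]_(y in D) f r y)%:E)%E); last first.
  by apply: eq_integral => r Dr; rewrite integrandE.
rewrite -Rintegral_EFin//; last exact: integrable_scale.
congr EFin; rewrite RintegralZl// fubini.
have -> : \int[mu]_(y in D) \int[mu]_(r in D) f r y =
    \int[mu]_(y in D) (pi / sinh (pi * tau) * g y).
  by apply: eq_Rintegral => y Dy; rewrite innerE.
rewrite RintegralZl// integral_gauss_sin_sin//.
have expE s : s ^+ 2 = 1 -> expR (- (t / 2 * (pi / t + s * tau) ^+ 2)) =
    (expR (pi ^+ 2 / (2 * t)))^-1 * expR (- (t / 2 * tau ^+ 2)) *
    expR (- (s * (pi * tau))).
  move=> s2; rewrite -expRN -!expRD; congr expR.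
  have -> : (pi / t + s * tau) ^+ 2 =
    (pi / t) ^+ 2 + 2 * (pi / t) * (s * tau) + s ^+ 2 * tau ^+ 2 by ring.
  by rewrite s2; move: pi => p; field.
have := expE 1 (expr1n _ _); rewrite !mul1r => ->.
have := expE (-1) (ltac:(by rewrite sqrrN expr1n)); rewrite !mulN1r opprK => ->.
have k0 : Num.sqrt (2 * pi ^+ 3 * t) != 0.
  by rewrite gt_eqF// sqrtr_gt0 !mulr_gt0// exprn_gt0.
have kE : Num.sqrt (2 * pi ^+ 3 * t) = pi * Num.sqrt (2 * pi * t).
  rewrite (_ : 2 * pi ^+ 3 * t = pi ^+ 2 * (2 * pi * t)); last by ring.
  by rewrite sqrtrM ?sqr_ge0// sqrtr_sqr ger0_norm// ltW.
have q0 : Num.sqrt (2 * pi * t) != 0.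
  by rewrite gt_eqF// sqrtr_gt0 !mulr_gt0.
have e0 : expR (pi ^+ 2 / (2 * t)) != 0 by rewrite gt_eqF// expR_gt0.
have pn0 : pi != 0 :> R by rewrite gt_eqF.
have shE : expR (pi * tau) - expR (- (pi * tau)) = 2 * sinh (pi * tau).
  by rewrite /sinh; field.
rewrite -mulrBr shE /C kE.
move: e0 q0 sh0 pn0; move: (sinh _) => sh; move: (Num.sqrt _) => q.
move: (expR (- _)) => E'; move: (expR _) => E; move: pi => p e0 q0 sh0 pn0.
by field; rewrite e0 q0 sh0 pn0.
Qed.

End inversion.

Theorem mainTheorem4 (R : realType) :
  (forall r t : R, 0 < r -> 0 < t ->
     (yor_integral t r)%:E =
     ((1 / (r * pi ^+ 2))%:E *
      \int[@lebesgue_measure R]_(tau in `]0%R, +oo[)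
        (expR (- (t / 2 * tau ^+ 2)) * tau * sinh (pi * tau) *
         macdonald_im tau r)%:E)%E) /\
  (forall t tau : R, 0 < t -> 0 < tau ->
     (\int[@lebesgue_measure R]_(r in `]0%R, +oo[)
        (macdonald_im tau r * yor_integral t r)%:E)%E =
     (expR (- (t / 2 * tau ^+ 2)) / 2)%:E).
Proof.
split; [exact: yor_integral_spectral|exact: macdonald_yor_integral].
Qed.
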